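(* Let $\mathbf{k}$ be a field and $B = \mathbf{k}[x,y,z]/(xy,yz,xz)$ with its standard grading. The following three cones in $\mathbf{V}$ are equal: (i) the cone $\mathrm{B}_{\mathbf{Q}}(B)$, i.e. the $\mathbf{Q}_{\ge 0}$-span of the Betti tables $\beta^B(M)$ of all finitely generated graded $B$-modules $M$; (ii) the cone $D$, i.e. the $\mathbf{Q}_{\ge 0}$-span of the tables $\pi_d$ for all $B$-degree sequences $d$; (iii) the cone $F \subseteq \mathbf{V}$ defined as the intersection of the halfspaces $\{\epsilon_{i,j} \ge 0\}$ for all $i \ge 0$ and $j \in \mathbf{Z}$, the halfspaces $\{\alpha_k \ge 0\}$ for all $k \in \mathbf{Z}$, the halfspaces $\{\gamma_k \ge 0\}$ for all $k \in \mathbf{Z}$, and the subspaces $\{2\epsilon_{i,j} = \epsilon_{i+1,j+1}\}$ for all $i \ge 2$ and $j \in \mathbf{Z}$.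
   Context: $\mathbf{V}$ is the $\mathbf{Q}$-vector space of tables $v=(v_{i,j})$ of rational numbers, indexed by integers $i \ge 0$ and $j \in \mathbf{Z}$, such that for each $i$ there are only finitely many $j$ with $v_{i,j} \ne 0$. For a finitely generated graded $B$-module $M$, its Betti table $\beta^B(M) \in \mathbf{V}$ has entries $\beta^B(M)_{i,j} = \dim_{\mathbf{k}} \operatorname{Tor}^B_i(M,\mathbf{k})_j$. A $B$-degree sequence is a sequence $d$ of one of the three forms $(d_0,\infty,\infty,\dots)$, $(d_0,d_1,\infty,\infty,\dots)$, $(d_0,d_1,d_1+1,d_1+2,\dots)$ with $d_0, d_1$ integers and $d_0<d_1$ (in the third form $d_i = d_1 + i-1$ for $i \ge 1$). For each such $d$ define $\pi_d \in \mathbf{V}$ as follows. In all cases $(\pi_d)_{0,j} = 1$ if $j=d_0$ and $0$ otherwise. - If $d=(d_0,\infty,\infty,\dots)$, then $(\pi_d)_{i,j}=0$ for all $i \ge 1$ and all $j$. - If $d=(d_0,d_1,\infty,\dots)$, then $(\pi_d)_{1,j}=1$ if $j=d_1$ and $0$ otherwise, and $(\pi_d)_{i,j}=0$ for $i\ge 2$. - If $d=(d_0,d_1,d_1+1,d_1+2,\dots)$, then for $i \ge 1$, $(\pi_d)_{i,j} = 3\cdot 2^{i-1}$ if $j=d_i$ and $0$ otherwise. For $v\in\mathbf{V}$ the linear functionals are $$\epsilon_{i,j}(v)=v_{i,j},\qquad \alpha_k(v) = 2\epsilon_{1,k}(v)-\epsilon_{2,k+1}(v),\qquad \gamma_k(v)=\sum_{j\le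 k}\bigl(3\epsilon_{0,j}(v)-3\epsilon_{1,j+1}(v)+\epsilon_{2,j+2}(v)\bigr),$$ where the last sum has only finitely many nonzero terms. *)

(* Defs.v *)
From HB Require Import structures.
From mathcomp Require Import all_boot all_order all_algebra.
From mathcomp Require Import generic_quotient ring_quotient.
From mathcomp Require Import mpoly.
From mathcomp Require Import boolp classical_sets functions cardinality fsbigop.

Set Implicit Arguments.
Unset Strict Implicit.
Unset Printing Implicit Defensive.

Import Order.TTheory GRing.Theory Num.Theory.

Local Open Scope classical_set_scope.
Local Open Scope ring_scope.
Local Open Scope quotient_scope.

(** ** The ring B = k[x,y,z]/(xy, yz, xz) *)

Section Ring.
Variable k : fieldType.

Definition varx : {mpoly k[3]} := 'X_(inord 0).
Definition vary : {mpoly k[3]} := 'X_(inord 1).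
Definition varz : {mpoly k[3]} := 'X_(inord 2).

Definition Bideal : {pred {mpoly k[3]}} := fun p =>
  `[< exists a b c : {mpoly k[3]},
        p = a * (varx * vary) + b * (vary * varz) + c * (varx * varz) >].

Lemma BidealP (p : {mpoly k[3]}) :
  reflect (exists a b c : {mpoly k[3]},
    p = a * (varx * vary) + b * (vary * varz) + c * (varx * varz))
  (p \in Bideal).
Proof. exact: asboolP. Qed.

Lemma Bideal_coef0 (p : {mpoly k[3]}) : p \in Bideal -> p@_0%MM = 0.
Proof.
case/BidealP=> a [b [c ->]].
have X0 i : ('X_i : {mpoly k[3]})@_0%MM = 0 by rewrite mcoeffX mnm1_eq0.
rewrite !mcoeffD !(rmorphM (mcoeff 0%MM)) /= /varx /vary /varz !X0.
by rewrite !mul0r !mulr0 !addr0.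
Qed.

Lemma Bideal_closed : idealr_closed Bideal.
Proof.
split.
- by apply/BidealP; exists 0, 0, 0; rewrite !mul0r !addr0.
- by apply/negP => /Bideal_coef0/eqP; rewrite mcoeff1 eqxx oner_eq0.
- move=> u p q /BidealP[a [b [c ->]]] /BidealP[a' [b' [c' ->]]].
  apply/BidealP; exists (u * a + a'), (u * b + b'), (u * c + c').
  by rewrite !mulrDl !mulrDr !mulrA !addrA; do !rewrite [_ + a' * _ * _]addrAC;
     do !rewrite [_ + b' * _ * _]addrAC.
Qed.

HB.instance Definition _ :=
  isIdealr.Build {mpoly k[3]} Bideal Bideal_closed.

Definition B : Type := {ideal_quot Bideal}.
HB.instance Definition _ := GRing.ComNzRing.on B.

Definition Bproj (p : {mpoly k[3]}) : B := \pi_{ideal_quot Bideal} p.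

Definition Bhomog (d : int) : set B :=
  if d is Posz n then [set b | exists2 p, p \is n.-homog & b = Bproj p]
  else [set 0].

(* The augmentation B -> B/(x,y,z) = k.  It does not depend on the
   representative, by Baug_proj. *)
Definition Baug (b : B) : k := (repr (b : {ideal_quot Bideal}))@_0%MM.

Lemma Baug_proj (p : {mpoly k[3]}) : Baug (Bproj p) = p@_0%MM.
Proof.
apply/eqP; rewrite -subr_eq0 -mcoeffB; apply/eqP/Bideal_coef0.
by rewrite Quotient.idealrBE /Bproj reprK.
Qed.

End Ring.

(** ** Graded B-modules *)

Record graded_module (k : fieldType) := GradedModule {
  gm_sort :> lmodType (B k);
  gm_piece : int -> set gm_sort;
  gm_piece0 : forall j, gm_piece j 0;
  gm_pieceB : forall j u v, gm_piece j u -> gm_piece j v -> gm_piece j (u - v);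
  gm_pieceZ : forall d j b u,
    Bhomog d b -> gm_piece j u -> gm_piece (d + j) (b *: u);
  gm_decomp : forall u, exists (s : seq int) (f : int -> gm_sort),
    (forall j, gm_piece j (f j)) /\ u = \sum_(j <- s) f j;
  gm_direct : forall (s : seq int) (f : int -> gm_sort), uniq s ->
    (forall j, gm_piece j (f j)) -> \sum_(j <- s) f j = 0 ->
    forall j, j \in s -> f j = 0
}.

Definition finitely_generated (k : fieldType) (M : lmodType (B k)) : Prop :=
  exists (n : nat) (g : 'I_n -> M),
    forall u, exists c : 'I_n -> B k, u = \sum_a c a *: g a.

(** ** Graded free resolutions and Tor *)

(* A resolution ... -> F_1 -> F_0 -> M -> 0 by finitely generated graded free
   modules F_i = \bigoplus_a B(- fr_deg i a), whose elements are row vectors;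
   matrices act on the right.  Since Bhomog vanishes in negative degrees,
   fr_diff_homog says that the differentials preserve degrees. *)
Record free_resolution (k : fieldType) (M : graded_module k) := FreeResolution {
  fr_rank : nat -> nat;
  fr_deg : forall i, 'I_(fr_rank i) -> int;
  fr_diff : forall i, 'M[B k]_(fr_rank i.+1, fr_rank i);
  fr_gen : 'I_(fr_rank 0) -> M;
  fr_diff_homog : forall i (a : 'I_(fr_rank i.+1)) (b : 'I_(fr_rank i)),
    Bhomog (fr_deg a - fr_deg b) (fr_diff i a b);
  fr_gen_homog : forall a, gm_piece (fr_deg a) (fr_gen a);
  fr_surj : forall u : M, exists w : 'rV[B k]_(fr_rank 0),
    u = \sum_a w 0 a *: fr_gen a;
  fr_exact0 : forall w : 'rV[B k]_(fr_rank 0),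
    \sum_a w 0 a *: fr_gen a = 0 <-> exists w', w = w' *m fr_diff 0;
  fr_exact : forall i (w : 'rV[B k]_(fr_rank i.+1)),
    w *m fr_diff i = 0 <-> exists w', w = w' *m fr_diff i.+1
}.

Arguments fr_deg {k M} f i a.

Section Tor.
Variables (k : fieldType) (M : graded_module k) (F : free_resolution M).

(* The differential of the complex of k-vector spaces F \otimes_B k. *)
Definition tens_diff (i : nat) : 'M[k]_(fr_rank F i.+1, fr_rank F i) :=
  map_mx (@Baug k) (fr_diff F i).

(* The row space of tens_deg i j is the degree j part of F_i \otimes_B k. *)
Definition tens_deg (i : nat) (j : int) : 'M[k]_(fr_rank F i) :=
  diag_mx (\row_a (fr_deg F i a == j)%:R).

Definition tens_cycles (i : nat) : 'M[k]_(fr_rank F i) :=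
  if i is i'.+1 then kermx (tens_diff i') else 1%:M.

(* (Z :\: Y)%MS is a complement of Z :&: Y in Z, so its rank is the dimension
   of Z / Y when Y is contained in Z. *)
Definition dim_Tor (i : nat) (j : int) : nat :=
  \rank ((tens_cycles i :&: tens_deg i j) :\: (tens_deg i.+1 j *m tens_diff i))%MS.

End Tor.

(** ** Tables *)

Definition table := nat -> int -> rat.

Definition V : set table :=
  [set v | forall i, finite_set [set j | v i j != 0]].

Definition cone_span (S : set table) : set table :=
  [set v | exists (n : nat) (c : 'I_n -> rat) (t : 'I_n -> table),
    [/\ forall l, 0 <= c l, forall l, S (t l) &
        forall i j, v i j = \sum_l c l * t l i j]].

(* Tor does not depend on the resolution used to compute it. *)
Definition is_betti_table (k : fieldType) (M : graded_module k) (v : table)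
  : Prop :=
  exists F : free_resolution M, forall i j, v i j = (dim_Tor F i j)%:R.

Definition betti_cone (k : fieldType) : set table :=
  cone_span [set v | exists M : graded_module k,
    finitely_generated M /\ is_betti_table M v].

(** ** Degree sequences *)

Variant degree_sequence :=
  | DegFree (d0 : int)
  | DegFin (d0 d1 : int) of d0 < d1
  | DegInf (d0 d1 : int) of d0 < d1.

(* None stands for infinity. *)
Definition degseq_nth (d : degree_sequence) (i : nat) : option int :=
  match d, i with
  | DegFree d0, 0%N => Some d0
  | DegFree _, _ => None
  | DegFin d0 _ _, 0%N => Some d0
  | DegFin _ d1 _, 1%N => Some d1
  | DegFin _ _ _, _ => None
  | DegInf d0 _ _, 0%N => Some d0
  | DegInf _ d1 _, i'.+1 => Some (d1 + i'%:Z)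
  end.

Definition pure_coef (d : degree_sequence) (i : nat) : rat :=
  match d, i with
  | DegInf _ _ _, i'.+1 => 3 * 2 ^+ i'
  | _, _ => 1
  end.

Definition pure_table (d : degree_sequence) : table :=
  fun i j => if degseq_nth d i == Some j then pure_coef d i else 0.

Definition degree_cone : set table := cone_span (range pure_table).

(** ** Functionals *)

Definition epsilon (i : nat) (j : int) (v : table) : rat := v i j.

Definition alpha (l : int) (v : table) : rat :=
  2 * epsilon 1 l v - epsilon 2 (l + 1) v.

Definition gamma (l : int) (v : table) : rat :=
  \sum_(j \in [set j : int | j <= l])
    (3 * epsilon 0 j v - 3 * epsilon 1 (j + 1) v + epsilon 2 (j + 2) v).

Definition facet_cone : set table :=
  [set v | [/\ V v,
    forall i j, 0 <= epsilon i j v,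
    forall l, 0 <= alpha l v,
    forall l, 0 <= gamma l v &
    forall i j, (2 <= i)%N -> 2 * epsilon i j v = epsilon i.+1 (j + 1) v]].

(* Main.v *)
(** The evaluations of B on the three coordinate axes embed it into
    k[x] * k[y] * k[z].  Setting the variables to 1, a graded free resolution of
    a B-module becomes three complexes of filtered k-vector spaces C_x, C_y, C_z
    with the same associated graded complex, whose degree j strand T_j computes
    Tor(M, k)_j; the degree j strand F_j of the resolution consists of the
    triples of vectors in filtration step j with the same image in T_j.  The
    exact sequences
      0 -> (+)_v C_v,<j -> F_j -> T_j -> 0  and  0 -> F_j -> (+)_v C_v,<=j -> T_j^2 -> 0
    and the acyclicity of F_j in positive degrees give
      beta_{i+1,j+1} = sum_v dim H_i(C_v,<=j) = 2 beta_{i,j}  for i >= 2,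
    with <= instead of the last = for i = 1.  The inequality gamma >= 0 comes from
    a rank count in 0 -> C_v,<j -> C_v,<=j -> T_j -> 0 that telescopes.  No
    minimality of the resolution is needed.

    A table of the facet cone is a combination of pure tables by a transport
    argument: gamma >= 0 says that the supply in row 0 is always ahead of the
    demand of the other rows.  Finally the pure tables are the Betti tables of B,
    of B/(x^n + y^n + z^n) and of B/(x^n, y^n, z^n). *)

From HB Require Import structures.
Require Import Defs.
From mathcomp Require Import all_boot all_order all_algebra.
From mathcomp Require Import generic_quotient ring_quotient.
From mathcomp Require Import mpoly.
From mathcomp Require Import boolp classical_sets functions cardinality fsbigop.
From mathcomp Require Import zify ring lra.

Set Implicit Arguments.
Unset Strict Implicit.
Unset Printing Implicit Defensive.

Import Order.TTheory GRing.Theory Num.Theory.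

Local Open Scope classical_set_scope.
Local Open Scope ring_scope.
Local Open Scope quotient_scope.

(** * The ring [B], its restrictions to the three coordinate axes, and its grading *)

Section RingB.
Variable k : fieldType.
Local Notation Bk := (B k).
Implicit Types (u v : 'I_3) (b : Bk) (n : nat).

Lemma Bproj_is_zmod_morphism : zmod_morphism (@Bproj k).
Proof. by move=> p q; rewrite /Bproj !piE. Qed.

Lemma Bproj_is_monoid_morphism : monoid_morphism (@Bproj k).
Proof. by split=> [|p q]; rewrite /Bproj !piE. Qed.

HB.instance Definition _ :=
  GRing.isZmodMorphism.Build {mpoly k[3]} Bk (@Bproj k) Bproj_is_zmod_morphism.
HB.instance Definition _ :=
  GRing.isMonoidMorphism.Build {mpoly k[3]} Bk (@Bproj k)
    Bproj_is_monoid_morphism.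

Lemma BprojP b : exists p, b = Bproj p.
Proof. by exists (repr (b : {ideal_quot (@Bideal k)})); rewrite /Bproj reprK. Qed.

Lemma Bproj_eq0 (p : {mpoly k[3]}) : (Bproj p == 0) = (p \in @Bideal k).
Proof.
by rewrite -(rmorph0 (@Bproj k)) -[p in RHS]subr0 Quotient.idealrBE.
Qed.

Definition Bvar v : Bk := Bproj 'X_v.

Definition axis_eval v : {mpoly k[3]} -> {poly k} :=
  mmap polyC (fun u => if u == v then 'X else 0).

HB.instance Definition _ v := GRing.RMorphism.on (axis_eval v).

Lemma axis_evalX u v : axis_eval v 'X_u = if u == v then 'X else 0.
Proof. by rewrite /axis_eval mmapX mmap1U. Qed.

Lemma axis_evalC c v : axis_eval v c%:MP = c%:P.
Proof. by rewrite /axis_eval mmapC. Qed.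

Lemma inord3 : [/\ inord 0 != inord 1 :> 'I_3, inord 1 != inord 2 :> 'I_3
  & inord 0 != inord 2 :> 'I_3].
Proof. by split; rewrite -val_eqE /= !inordK. Qed.

Lemma axis_eval_ideal v (p : {mpoly k[3]}) : p \in @Bideal k -> axis_eval v p = 0.
Proof.
case/BidealP=> a [b [c ->]].
have XM u w : u != w -> axis_eval v 'X_u * axis_eval v 'X_w = 0.
  move=> nuw; rewrite !axis_evalX; have [<-|_] := eqVneq u v; last by rewrite mul0r.
  by rewrite eq_sym (negPf nuw) mulr0.
have [n01 n12 n02] := inord3.
by rewrite !(rmorphD, rmorphM) /= /varx /vary /varz !XM // !mulr0 !addr0.
Qed.

(** Restriction of an element of [B] to the coordinate axis [v]. It is read off a chosen
    representative; [axis_proj] shows that the choice is irrelevant. *)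
Definition axis v b : {poly k} := axis_eval v (repr (b : {ideal_quot (@Bideal k)})).

Lemma axis_proj v p : axis v (Bproj p) = axis_eval v p.
Proof.
apply/eqP; rewrite -subr_eq0 -rmorphB; apply/eqP/axis_eval_ideal.
by rewrite Quotient.idealrBE /Bproj reprK.
Qed.

Lemma axis_is_zmod_morphism v : zmod_morphism (axis v).
Proof.
move=> b c; have [[p ->] [q ->]] := (BprojP b, BprojP c).
by rewrite -rmorphB !axis_proj rmorphB.
Qed.

Lemma axis_is_monoid_morphism v : monoid_morphism (axis v).
Proof.
split=> [|b c]; first by rewrite -(rmorph1 (@Bproj k)) axis_proj rmorph1.
have [[p ->] [q ->]] := (BprojP b, BprojP c).
by rewrite -rmorphM !axis_proj rmorphM.
Qed.

HB.instance Definition _ v :=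
  GRing.isZmodMorphism.Build Bk {poly k} (axis v) (axis_is_zmod_morphism v).
HB.instance Definition _ v :=
  GRing.isMonoidMorphism.Build Bk {poly k} (axis v) (axis_is_monoid_morphism v).

Lemma axisX u v : axis v (Bvar u) = if u == v then 'X else 0.
Proof. by rewrite axis_proj axis_evalX. Qed.

(** Since [0 ^+ 0 = 1], the product is the indicator that [m] involves no variable other than
    [v]. *)
Lemma axis_evalXm v (m : 'X_{1..3}) :
  axis_eval v 'X_[m] = (\prod_u (u == v)%:R ^+ m u)%:P * 'X ^+ mdeg m.
Proof.
rewrite /axis_eval mmapX /mmap1 mdegE -prodrXr rmorph_prod -big_split /=.
apply: eq_bigr => u _; rewrite rmorphXn -exprMn_comm; last exact: mulrC.
by congr (_ ^+ _); case: eqP; rewrite ?mul1r ?mul0r.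
Qed.

Lemma axis_eval0 v (p : {mpoly k[3]}) : (axis_eval v p)`_0 = p@_0%MM.
Proof.
elim/mpolyind: p => [|c m p _ _ IHp]; first by rewrite raddf0 coef0 mcoeff0.
rewrite rmorphD coefD mcoeffD IHp /=; congr (_ + _).
rewrite mcoeffZ mcoeffX -mul_mpolyC rmorphM /= axis_evalC axis_evalXm.
rewrite !coefCM coefXn [0 == _]eq_sym mdeg_eq0.
case: eqP => [->|_]; last by rewrite !mulr0.
by rewrite big1 ?mulr1 // => u _; rewrite mnm0E expr0.
Qed.

Lemma axis0 v b : (axis v b)`_0 = Baug b.
Proof. by have [p ->] := BprojP b; rewrite axis_proj Baug_proj axis_eval0. Qed.

Lemma Baug_is_zmod_morphism : zmod_morphism (@Baug k).
Proof. by move=> b c; rewrite -!(axis0 0) rmorphB coefB. Qed.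

Lemma Baug_is_monoid_morphism : monoid_morphism (@Baug k).
Proof.
by split=> [|b c]; rewrite -!(axis0 0) ?rmorph1 ?coefC // rmorphM coef0M.
Qed.

HB.instance Definition _ :=
  GRing.isZmodMorphism.Build Bk k (@Baug k) Baug_is_zmod_morphism.
HB.instance Definition _ :=
  GRing.isMonoidMorphism.Build Bk k (@Baug k) Baug_is_monoid_morphism.

Lemma BvarM u v : u != v -> Bvar u * Bvar v = 0.
Proof.
move=> neq_uv; apply/eqP; rewrite -rmorphM Bproj_eq0; apply/BidealP.
rewrite /varx /vary /varz; move: neq_uv; rewrite -val_eqE /=.
have XE w : 'X_w = 'X_(inord w) :> {mpoly k[3]} by rewrite inord_val.
rewrite (XE u) (XE v) {XE}.
case: (nat_of_ord u) (ltn_ord u) => [|[|[|//]]] _;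
  case: (nat_of_ord v) (ltn_ord v) => [|[|[|//]]] _ // _.
- by exists 1, 0, 0; rewrite !mul0r !addr0 mul1r.
- by exists 0, 0, 1; rewrite !mul0r !add0r mul1r.
- by exists 1, 0, 0; rewrite !mul0r !addr0 mul1r mulrC.
- by exists 0, 1, 0; rewrite !mul0r addr0 add0r mul1r.
- by exists 0, 0, 1; rewrite !mul0r !add0r mul1r mulrC.
- by exists 0, 1, 0; rewrite !mul0r addr0 add0r mul1r mulrC.
Qed.

Definition Bcst (c : k) : Bk := Bproj c%:MP.

HB.instance Definition _ := GRing.RMorphism.copy Bcst (@Bproj k \o @mpolyC 3 k).

Lemma axisC v c : axis v (Bcst c) = c%:P.
Proof. by rewrite axis_proj axis_evalC. Qed.

Definition axis_inj v (f : {poly k}) : Bk := (map_poly Bcst f).[Bvar v].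

Lemma axis_inj_is_zmod_morphism v : zmod_morphism (axis_inj v).
Proof. by move=> f g; rewrite /axis_inj rmorphB hornerD hornerN. Qed.

HB.instance Definition _ v :=
  GRing.isZmodMorphism.Build {poly k} Bk (axis_inj v)
    (axis_inj_is_zmod_morphism v).

Lemma axis_injCM v c f : axis_inj v (c%:P * f) = Bcst c * axis_inj v f.
Proof. by rewrite /axis_inj rmorphM /= map_polyC hornerM hornerC. Qed.

Lemma axis_injXn v n : axis_inj v 'X^n = Bvar v ^+ n.
Proof. by rewrite /axis_inj map_polyXn hornerXn. Qed.

Lemma axis_injMX v f : axis_inj v (f * 'X) = axis_inj v f * Bvar v.
Proof. by rewrite /axis_inj rmorphM /= map_polyX hornerMX. Qed.

(** By linearity it suffices to treat monomials. A positive power of one variable survives on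
    exactly one axis, a mixed monomial is zero on both sides, and a constant is seen by all three
    axes, hence the correction by twice the constant term. *)
Lemma Baxes_decomp b : b + Bcst (Baug b) *+ 2 = \sum_v axis_inj v (axis v b).
Proof.
have [p ->] := BprojP b; rewrite Baug_proj.
under eq_bigr do rewrite axis_proj.
elim/mpolyind: p => [|c m p _ _ IHp].
  by rewrite mcoeff0 !rmorph0 mul0rn addr0 big1 // => v _; rewrite !raddf0.
under eq_bigr do rewrite rmorphD raddfD.
rewrite rmorphD mcoeffD rmorphD mulrnDl addrACA IHp big_split /=; congr (_ + _).
rewrite -mul_mpolyC rmorphM -/(Bcst c) mcoeffCM mcoeffX rmorphM -mulrnAr -mulrDr /=.
under eq_bigr do rewrite rmorphM /= axis_evalC axis_injCM axis_evalXm axis_injCM.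
rewrite -mulr_sumr; congr (_ * _).
under eq_bigr do rewrite axis_injXn.
have -> : Bproj 'X_[m] = \prod_u Bvar u ^+ m u.
  rewrite mpolyXE_id rmorph_prod; apply: eq_bigr => u _.
  by rewrite rmorphXn.
have [->|m0] := eqVneq m 0%MM.
  rewrite rmorph1 mdeg0 big1 => [|u _]; last by rewrite mnm0E expr0.
  under eq_bigr => v _.
    rewrite big1 => [|u _]; last by rewrite mnm0E expr0.
    rewrite rmorph1 mul1r expr0; over.
  by rewrite sumr_const card_ord -mulrS.
rewrite rmorph0 mul0rn addr0.
have [u mu0] : exists u, m u != 0%N.
  apply/existsP; apply: contraNT m0; rewrite negb_exists => /forallP m0.
  by apply/eqP/mnmP => i; rewrite mnm0E; apply/eqP; rewrite -[_ == _]negbK.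
have [/existsP[v /andP[nvu mv0]]|] := boolP [exists v, (v != u) && (m v != 0%N)].
  transitivity (0 : Bk).
    rewrite (bigD1 u) // (bigD1 v) //= mulrA.
    case: (m u) (m v) mu0 mv0 => [//|a] [//|c'] _ _.
    by rewrite !exprS mulrACA BvarM 1?eq_sym // !mul0r.
  apply/esym/big1 => w _; rewrite [X in Bcst X](_ : _ = 0) ?rmorph0 ?mul0r //.
  apply/eqP/prodf_eq0; have [wu|wu] := eqVneq w u.
    by exists v => //; rewrite wu (negPf nvu) expr0n (negPf mv0).
  by exists u => //; rewrite [u == w]eq_sym (negPf wu) expr0n (negPf mu0).
rewrite negb_exists => /forallP mE.
have {}mE v : v != u -> m v = 0%N.
  by move=> nvu; move: (mE v); rewrite nvu /= negbK => /eqP.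
rewrite (bigD1 u) //= big1 => [|v /mE->]; last by rewrite expr0.
rewrite mulr1 (bigD1 u) //= [X in _ + X]big1 => [|v nvu].
  have -> : mdeg m = m u by rewrite mdegE (bigD1 u) //= big1 ?addn0 // => v /mE.
  rewrite addr0 big1 => [|v _]; last first.
    by have [->|/mE->] := eqVneq v u; rewrite ?expr1n ?expr0.
  by rewrite rmorph1 mul1r.
rewrite [X in Bcst X](_ : _ = 0) ?rmorph0 ?mul0r //.
by apply/eqP/prodf_eq0; exists u => //; rewrite [u == v]eq_sym (negPf nvu) expr0n (negPf mu0).
Qed.

(** This is the embedding of [B] into the product of the three axis rings. *)
Lemma axis_inj_eq0 b : (forall v, axis v b = 0) -> b = 0.
Proof.
move=> b0; have := Baxes_decomp b.
rewrite -(axis0 0) b0 coef0 rmorph0 mul0rn addr0 => ->.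
by apply: big1 => v _; rewrite b0 raddf0.
Qed.

Lemma axis_ext b c : (forall v, axis v b = axis v c) -> b = c.
Proof.
move=> bc; apply/eqP; rewrite -subr_eq0; apply/eqP/axis_inj_eq0 => v.
by rewrite rmorphB /= bc subrr.
Qed.

(** On the axis [v] the ring is a domain, so [b] vanishes there and has no constant term. Its
    decomposition then consists of polynomials in the two other variables, each divisible by its
    variable. *)
Lemma Bvar_ann v b : b * Bvar v = 0 ->
  exists q : 'I_3 -> Bk, b = \sum_(u | u != v) q u * Bvar u.
Proof.
move=> /(congr1 (axis v)); rewrite rmorphM rmorph0 /= axisX eqxx => /eqP.
rewrite mulf_eq0 polyX_eq0 orbF => /eqP bv0.
have aug0 : Baug b = 0 by rewrite -(axis0 v) bv0 coef0.
have := Baxes_decomp b; rewrite aug0 rmorph0 mul0rn addr0 (bigD1 v) //=.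
rewrite bv0 raddf0 add0r => ->.
exists (fun u => axis_inj u (axis u b %/ 'X)); apply: eq_bigr => u _.
rewrite -axis_injMX divpK // -['X]subr0 -polyC0 dvdp_XsubCl /root.
by rewrite horner_coef0 axis0 aug0.
Qed.

(** The homogeneous element of degree [n] with prescribed coefficients on the axes. In degree 0 only
    a constant triple is realised, which is the side condition of [axis_triple]. *)
Definition Btriple n (c : 'I_3 -> k) : Bk :=
  if n is 0 then Bcst (c 0) else \sum_v Bcst (c v) * Bvar v ^+ n.

Lemma axis_triple n c v : (n = 0%N -> forall u, c u = c 0) ->
  axis v (Btriple n c) = (c v)%:P * 'X^n.
Proof.
case: n => [|n] c0 /=; first by rewrite axisC expr0 mulr1 [c v]c0.
rewrite rmorph_sum (bigD1 v) //= big1 => [|u nuv].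
  by rewrite addr0 rmorphM rmorphXn /= axisC axisX eqxx.
by rewrite rmorphM rmorphXn /= axisX (negPf nuv) expr0n mulr0.
Qed.

Lemma Btriple_homog n c : Bhomog (Posz n) (Btriple n c).
Proof.
case: n => [|n] /=.
  exists (c 0)%:MP => //.
  by rewrite -[_%:MP]mulr1 mul_mpolyC; apply/dhomogZ/dhomog1.
exists (\sum_v c v *: 'X_v ^+ n.+1).
  apply: rpred_sum => v _; apply: dhomogZ; rewrite mpolyXn dhomogX.
  by rewrite /= mdegMn mdeg1 mul1n.
by rewrite rmorph_sum; apply: eq_bigr => v _; rewrite -mul_mpolyC rmorphM rmorphXn.
Qed.

Lemma Bhomog0 d : Bhomog d (0 : Bk).
Proof. by case: d => n //=; exists 0; rewrite ?rmorph0 ?dhomog0. Qed.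

Lemma BhomogB d b c : Bhomog d b -> Bhomog d c -> Bhomog d (b - c).
Proof.
case: d => n /=; last by move=> -> ->; rewrite subrr.
by case=> p hp -> [q hq ->]; exists (p - q); rewrite ?rmorphB ?rpredB.
Qed.

Lemma BhomogD d b c : Bhomog d b -> Bhomog d c -> Bhomog d (b + c).
Proof.
move=> hb hc; rewrite -[c]opprK; apply: BhomogB => //.
by rewrite -sub0r; apply: BhomogB => //; apply: Bhomog0.
Qed.

Lemma Bhomog_sum (I : finType) d (f : I -> Bk) :
  (forall i, Bhomog d (f i)) -> Bhomog d (\sum_i f i).
Proof.
by move=> hf; elim/big_rec: _ => [|i b _]; [apply: Bhomog0|apply: BhomogD].
Qed.

Lemma BhomogM d e b c : Bhomog d b -> Bhomog e c -> Bhomog (d + e) (b * c).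
Proof.
case: d => n; last by move=> /= ->; rewrite mul0r => _; apply: Bhomog0.
case: e => m; last by move=> _ /= ->; rewrite mulr0; apply: Bhomog0.
case=> p hp -> [q hq ->]; exists (p * q); rewrite ?rmorphM //.
exact: dhomogM.
Qed.

Lemma Bvar_homog v : Bhomog 1 (Bvar v).
Proof. by exists 'X_v; rewrite // dhomogX /= mdeg1. Qed.

Definition axis1 v b : k := (axis v b).[1].

Lemma axis1_is_zmod_morphism v : zmod_morphism (axis1 v).
Proof. by move=> b c; rewrite /axis1 rmorphB hornerD hornerN. Qed.

Lemma axis1_is_monoid_morphism v : monoid_morphism (axis1 v).
Proof. by split=> [|b c]; rewrite /axis1 ?rmorph1 ?hornerC // rmorphM hornerM. Qed.

HB.instance Definition _ v :=
  GRing.isZmodMorphism.Build Bk k (axis1 v) (axis1_is_zmod_morphism v).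
HB.instance Definition _ v :=
  GRing.isMonoidMorphism.Build Bk k (axis1 v) (axis1_is_monoid_morphism v).

Lemma Bhomog_axis1 n b v : Bhomog (Posz n) b -> axis v b = (axis1 v b)%:P * 'X^n.
Proof.
rewrite /axis1.
case=> p /dhomogP hp ->; rewrite axis_proj [p]mpolyE rmorph_sum horner_sum.
rewrite rmorph_sum mulr_suml /= [LHS]big_seq [RHS]big_seq.
apply: eq_bigr => m /hp <-; rewrite -mul_mpolyC rmorphM /= axis_evalC axis_evalXm.
by rewrite !hornerM !hornerC hornerXn expr1n mulr1 rmorphM /= mulrA.
Qed.

Lemma axis1_lt0 d b v : d < 0 -> Bhomog d b -> axis1 v b = 0.
Proof. by case: d => //= n _ ->; rewrite rmorph0. Qed.

Lemma Baug_homog d b v : Bhomog d b -> Baug b = if d == 0 then axis1 v b else 0.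
Proof.
case: d => n hb; last by rewrite hb rmorph0.
by rewrite -(axis0 v) (Bhomog_axis1 v hb) coefCM coefXn [0%N == n]eq_sym; case: n {hb} => [|n]; rewrite ?mulr1 ?mulr0.
Qed.

(** The projection onto degree [d], reassembled from the coefficients on the axes. *)
Definition Bcomp (d : int) b : Bk :=
  if d is Posz n then Btriple n (fun v => (axis v b)`_n) else 0.

Lemma axis_comp n b v : axis v (Bcomp (Posz n) b) = ((axis v b)`_n)%:P * 'X^n.
Proof. by rewrite /Bcomp axis_triple // => -> u; rewrite !axis0. Qed.

Lemma Bcomp_homog d b : Bhomog d (Bcomp d b).
Proof. by case: d => n //; apply: Btriple_homog. Qed.

Lemma Bcomp_is_zmod_morphism d : zmod_morphism (Bcomp d).
Proof.
case: d => n b c /=; last by rewrite subrr.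
apply: axis_ext => v; rewrite rmorphB /= -![Btriple _ _]/(Bcomp (Posz n) _).
by rewrite !axis_comp rmorphB coefB rmorphB mulrBl.
Qed.

HB.instance Definition _ d :=
  GRing.isZmodMorphism.Build Bk Bk (Bcomp d) (Bcomp_is_zmod_morphism d).

Lemma Bcomp_id d e b : Bhomog d b -> Bcomp e b = if e == d then b else 0.
Proof.
case: d => n hb; last by rewrite hb raddf0 if_same.
case: e => [e|e]; last by case: n hb.
apply: axis_ext => v; rewrite axis_comp (Bhomog_axis1 v hb) coefCM coefXn.
have -> : (Posz e == Posz n) = (e == n) by [].
case: eqP => [->|_]; last by rewrite mulr0 mul0r rmorph0.
by rewrite mulr1 -(Bhomog_axis1 v hb).
Qed.

Lemma BcompM d e b c : Bhomog d c -> Bcomp e (b * c) = Bcomp (e - d) b * c.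
Proof.
case: d => n hc; last by rewrite hc !mulr0 raddf0.
case: e => [e|e]; last first.
  have : Negz e - Posz n < 0 by lia.
  by case: (Negz e - Posz n) => // ? _; rewrite mul0r.
have [le_ne|lt_en] := leqP n e; last first.
  have : Posz e - Posz n < 0 by lia.
  case: (Posz e - Posz n) => // ? _; rewrite mul0r.
  apply: axis_ext => v; rewrite axis_comp rmorphM /= (Bhomog_axis1 v hc).
  by rewrite mulrCA coefCM coefMXn lt_en mulr0 !rmorph0 mul0r.
have -> : Posz e - Posz n = Posz (e - n) by lia.
apply: axis_ext => v; rewrite rmorphM /= !axis_comp rmorphM /= (Bhomog_axis1 v hc).
rewrite mulrCA coefCM coefMXn ltnNge le_ne /= rmorphM /=.
have -> : 'X^e = 'X^(e - n) * 'X^n :> {poly k} by rewrite -exprD subnK.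
ring.
Qed.

(** Stated for every large [n], so that finitely many elements can share one bound. *)
Lemma Bcomp_sum b : exists N, forall n, (N <= n)%N ->
  b = \sum_(i < n) Bcomp (Posz i) b.
Proof.
exists (\max_v size (axis v b)) => n le_n; apply: axis_ext => v.
rewrite rmorph_sum /=; under eq_bigr do rewrite axis_comp mul_polyC.
rewrite -poly_def; apply/polyP => i; rewrite coef_poly; case: ltnP => // le_ni.
by rewrite nth_default // (leq_trans _ le_ni) // (leq_trans _ le_n) // leq_bigmax.
Qed.

End RingB.

Arguments Bvar {k} v.

(** * Comparing dimensions of subquotients by linear relations *)

Section QuotientRank.
Variable K : fieldType.

(* Z :\: B stands for the quotient Z / B.  A linear relation that reaches all
   of Z1 and pulls B2 back into B1 induces an injection of Z1 / B1 into
   Z2 / B2. *)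
Lemma rank_quotient_le m1 m2 n1 p1 p2 n2
  (Z1 : 'M[K]_(m1, n1)) (B1 : 'M_(p1, n1)) (Z2 : 'M[K]_(m2, n2)) (B2 : 'M_(p2, n2))
  (R : 'rV_n1 -> 'rV_n2 -> Prop) :
  R 0 0 ->
  (forall a x y x' y', R x y -> R x' y' -> R (a *: x + x') (a *: y + y')) ->
  (forall x, (x <= Z1)%MS -> exists2 y, (y <= Z2)%MS & R x y) ->
  (forall x y, R x y -> (y <= B2)%MS -> (x <= B1)%MS) ->
  (\rank (Z1 :\: B1) <= \rank (Z2 :\: B2))%N.
Proof.
move=> R0 Rlin Rtot RB; pose X := row_base (Z1 :\: B1)%MS.
have XZ i : (row i X <= Z1)%MS.
  by rewrite (submx_trans (row_sub i X)) // eq_row_base diffmxSl.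
have /choice[Y YP] i : exists y : 'rV_n2, (y <= Z2)%MS /\ R (row i X) y.
  by have [y Zy Ry] := Rtot _ (XZ i); exists y.
pose M : 'M_(_, n2) := \matrix_i Y i.
have RM (c : 'rV_(\rank (Z1 :\: B1))) : R (c *m X) (c *m M).
  rewrite !mulmx_sum_row; elim/big_rec2: _ => [//|i y x _ Rxy].
  by apply: Rlin => //; rewrite rowK; case: (YP i).
(* The rows of [X] span a complement of [B1] in [Z1]. A combination whose image lies in [B2] is
   pulled back into [B1], hence is zero; so [M] is free and independent of [B2]. *)
have MB (c : 'rV_(\rank (Z1 :\: B1))) : (c *m M <= B2)%MS -> c = 0.
  move=> /(RB _ _ (RM c)) cB.
  have : (c *m X <= (Z1 :\: B1) :&: B1)%MS.
    by rewrite sub_capmx cB andbT (submx_trans (submxMl _ _)) // eq_row_base.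
  rewrite capmx_diff submx0 => /eqP/(congr1 (mulmx^~ (pinvmx X))) /=.
  by rewrite mul0mx mulmxKp ?row_base_free.
have Mfree : row_free M.
  by apply: inj_row_free => c cM; apply: MB; rewrite cM sub0mx.
have ZM : (M <= Z2)%MS.
  by apply/row_subP => i; rewrite rowK; case: (YP i).
have MB0 : (M :&: (Z2 :&: B2))%MS = 0.
  apply/eqP/rowV0P => v; rewrite !sub_capmx => /andP[/submxP[c ->]].
  by case/andP=> _ /MB ->; rewrite mul0mx.
have := mxrankS (_ : (M + (Z2 :&: B2) <= Z2)%MS).
rewrite addsmx_sub ZM capmxSl mxrank_disjoint_sum // => /(_ isT).
by rewrite (eqP Mfree) -(mxrank_cap_compl Z2 B2) addnC leq_add2l.
Qed.

Lemma rank_quotient m n p (Z : 'M[K]_(m, n)) (B : 'M_(p, n)) :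
  (B <= Z)%MS -> (\rank B + \rank (Z :\: B) = \rank Z)%N.
Proof.
move=> BZ; rewrite -(mxrank_cap_compl Z B); congr (_ + _)%N.
by apply/eqmx_rank; rewrite capmxSr sub_capmx BZ submx_refl.
Qed.

Lemma sub_mxdiag p n (A : 'I_p -> 'M[K]_n) (w : 'I_p -> 'rV_n) :
  (\mxrow_i w i <= \mxdiag_i A i)%MS <-> forall i, (w i <= A i)%MS.
Proof.
split=> [/submxP[D] | wA].
  rewrite -[D]submxrowK mul_mxrow_mxdiag => /eq_mxrowP wE i.
  by rewrite wE submxMl.
have /choice[D DE] i : exists D, w i = D *m A i by apply/submxP.
by apply/submxP; exists (\mxrow_i D i); rewrite mul_mxrow_mxdiag; apply/eq_mxrowP.
Qed.

Lemma rank_quotient_mxdiag p m n (Z : 'I_p -> 'M[K]_n) (B : 'I_p -> 'M_(m, n)) :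
  (forall i, B i <= Z i)%MS ->
  \rank ((\mxdiag_i Z i) :\: (\mxdiag_i <<B i>>))%MS =
  (\sum_i \rank (Z i :\: B i)%MS)%N.
Proof.
move=> BZ; have BZ' : (\mxdiag_i <<B i>> <= \mxdiag_i Z i)%MS.
  apply/row_subP => i; rewrite -[row i _]submxrowK; apply/sub_mxdiag => j.
  have /sub_mxdiag/(_ j) : (\mxrow_j submxrow (row i (\mxdiag_i <<B i>>%MS)) j
    <= \mxdiag_i <<B i>>)%MS by rewrite submxrowK row_sub.
  by move/submx_trans; apply; rewrite genmxE.
apply/eqP; rewrite -(eqn_add2l (\rank (\mxdiag_i <<B i>>)%MS)) rank_quotient //.
rewrite !rank_mxdiag -big_split; apply/eqP/eq_bigr => i _ /=.
by rewrite genmxE rank_quotient.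
Qed.

(** Direct sums are encoded as block-diagonal matrices, which reduces a relation between families of
    vectors to [rank_quotient_le]. *)
Lemma sum_rank_quotient_le p q m1 m2 n1 n2
  (Z1 : 'I_p -> 'M[K]_n1) (B1 : 'I_p -> 'M_(m1, n1))
  (Z2 : 'I_q -> 'M[K]_n2) (B2 : 'I_q -> 'M_(m2, n2))
  (R : ('I_p -> 'rV_n1) -> ('I_q -> 'rV_n2) -> Prop) :
  (forall i, B1 i <= Z1 i)%MS -> (forall i, B2 i <= Z2 i)%MS ->
  R (fun=> 0) (fun=> 0) ->
  (forall a x y x' y', R x y -> R x' y' ->
     R (fun i => a *: x i + x' i) (fun i => a *: y i + y' i)) ->
  (forall x, (forall i, x i <= Z1 i)%MS ->
     exists2 y, (forall i, y i <= Z2 i)%MS & R x y) ->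
  (forall x y, R x y -> (forall i, y i <= B2 i)%MS -> forall i, (x i <= B1 i)%MS) ->
  (\sum_i \rank (Z1 i :\: B1 i)%MS <= \sum_i \rank (Z2 i :\: B2 i)%MS)%N.
Proof.
move=> BZ1 BZ2 R0 Rlin Rtot RB; rewrite -!rank_quotient_mxdiag //.
apply: (@rank_quotient_le _ _ _ _ _ _ _ _ _ _
  (fun x y => R (fun i => submxrow x i) (fun i => submxrow y i))).
- rewrite (_ : (fun i => _) = fun=> 0); last by apply/funext => i; rewrite submxrow0.
  by rewrite (_ : (fun i => _) = fun=> 0) //; apply/funext => i; rewrite submxrow0.
- move=> a x y x' y' Rxy Rxy'; move: (Rlin a _ _ _ _ Rxy Rxy').
  by congr R; apply/funext => i; apply/matrixP => ? ?; rewrite !mxE.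
- move=> x; rewrite -{1}[x]submxrowK => /sub_mxdiag/Rtot[y yZ Ry].
  exists (\mxrow_i y i); first exact/sub_mxdiag.
  by rewrite (_ : (fun i => submxrow (\mxrow_i y i) i) = y) //; apply/funext => i; rewrite mxrowK.
- move=> x y Rxy; rewrite -{1}[y]submxrowK => /sub_mxdiag yB.
  rewrite -[x]submxrowK; apply/sub_mxdiag => i; rewrite genmxE.
  by apply: (RB _ _ Rxy) => j; move: (yB j); rewrite genmxE.
Qed.

Lemma submxB m n p (A B : 'M[K]_(m, n)) (D : 'M_(p, n)) :
  (A <= D -> B <= D -> A - B <= D)%MS.
Proof. by move=> AD BD; rewrite addmx_sub // eqmx_opp. Qed.

Lemma sub_diagP n (P : pred 'I_n) (w : 'rV[K]_n) :
  reflect (forall a, ~~ P a -> w 0 a = 0) (w <= diag_mx (\row_a (P a)%:R))%MS.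
Proof.
apply: (iffP submxP) => [[D ->] a Pa | w0].
  by rewrite mul_mx_diag !mxE (negPf Pa) mulr0.
exists w; rewrite mul_mx_diag; apply/rowP => a; rewrite !mxE.
by have [Pa|/w0->] := boolP (P a); rewrite ?mulr1 ?mul0r.
Qed.

Lemma sub_diag_fixP n (P : pred 'I_n) (w : 'rV[K]_n) :
  reflect (w *m diag_mx (\row_a (P a)%:R) = w) (w <= diag_mx (\row_a (P a)%:R))%MS.
Proof.
apply: (iffP (sub_diagP _ _)) => [w0 | <- a Pa]; last first.
  by rewrite mul_mx_diag !mxE (negPf Pa) mulr0.
rewrite mul_mx_diag; apply/rowP => a; rewrite !mxE.
by have [Pa|/w0->] := boolP (P a); rewrite ?mulr1 ?mul0r.
Qed.

Lemma sub_mulmxP m n p (A : 'M[K]_(m, n)) (C : 'M_(n, p)) (w : 'rV_p) :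
  reflect (exists2 q : 'rV_n, (q <= A)%MS & w = q *m C) (w <= A *m C)%MS.
Proof.
apply: (iffP submxP) => [[D ->]|[q /submxP[D ->] ->]].
  by exists (D *m A); rewrite ?submxMl ?mulmxA.
by exists D; rewrite mulmxA.
Qed.

End QuotientRank.

(** * Homology of the filtered complexes [C v] and of their associated graded complex [T] *)

(* An exact complex of graded free B-modules, seen through the embedding of B
   into k[x] * k[y] * k[z]: setting the three variables to 1 turns the
   differentials into the scalar matrices C v, which respect the filtration of
   row vectors by degree, and a homogeneous element becomes a triple of vectors
   agreeing in their top degree. *)
Section FilteredComplex.
Variables (K : fieldType) (r : nat -> nat) (d : forall i, 'I_(r i) -> int).
Variables (C : 'I_3 -> forall i, 'M[K]_(r i.+1, r i)).
Variables (T : forall i, 'M[K]_(r i.+1, r i)).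

Definition le_part i (j : int) : 'M[K]_(r i) := diag_mx (\row_a (d a <= j)%R%:R).
Definition eq_part i (j : int) : 'M[K]_(r i) := diag_mx (\row_a (d a == j)%:R).

Definition homog_triple i (j : int) (w : 'I_3 -> 'rV[K]_(r i)) : Prop :=
  (forall v, w v <= le_part i j)%MS /\
  (forall v, w v *m eq_part i j = w 0 *m eq_part i j).

Hypothesis C_filt : forall v i (a : 'I_(r i.+1)) (b : 'I_(r i)),
  d a < d b -> C v i a b = 0.
Hypothesis T_def : forall v i (a : 'I_(r i.+1)) (b : 'I_(r i)),
  T i a b = if d a == d b then C v i a b else 0.
Hypothesis C_sq : forall v i, C v i.+1 *m C v i = 0.
Hypothesis T_sq : forall i, T i.+1 *m T i = 0.
Hypothesis C_exact : forall i j (w : 'I_3 -> 'rV[K]_(r i.+1)),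
  homog_triple j w -> (forall v, w v *m C v i = 0) ->
  exists2 w', homog_triple j w' & forall v, w v = w' v *m C v i.+1.

Lemma le_partP i j (w : 'rV_(r i)) :
  reflect (forall a, j < d a -> w 0 a = 0) (w <= le_part i j)%MS.
Proof.
by apply: (iffP (sub_diagP _ _)) => w0 a; move: (w0 a); rewrite -ltNge.
Qed.

Lemma eq_partP i j (w : 'rV_(r i)) :
  reflect (forall a, d a != j -> w 0 a = 0) (w <= eq_part i j)%MS.
Proof. exact: sub_diagP. Qed.

Lemma mul_eq_part i j (w : 'rV_(r i)) a :
  (w *m eq_part i j) 0 a = if d a == j then w 0 a else 0.
Proof. by rewrite mul_mx_diag !mxE; case: eqP; rewrite ?mulr1 ?mulr0. Qed.

Lemma eq_part_id i j (w : 'rV_(r i)) :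
  (w <= eq_part i j)%MS -> w *m eq_part i j = w.
Proof. by move/sub_diag_fixP. Qed.

Lemma eq_part_le i j (w : 'rV_(r i)) :
  (w <= eq_part i j)%MS -> (w <= le_part i j)%MS.
Proof.
by move/eq_partP => w0; apply/le_partP => a ja; apply: w0; rewrite gt_eqF.
Qed.

Lemma le_part_pred i j (w : 'rV_(r i)) : (w <= le_part i (j - 1))%MS =
  (w <= le_part i j)%MS && (w *m eq_part i j == 0).
Proof.
apply/le_partP/andP => [w0|[/le_partP w0 /eqP wj] a aj].
  split; first by apply/le_partP => a ja; apply: w0; lia.
  apply/eqP/rowP => a; rewrite mul_eq_part [RHS]mxE; case: eqP => // aj.
  by apply: w0; lia.
have [aj'|aj'] := leP (d a) j; last exact: w0.
by have /rowP/(_ a) := wj; rewrite mul_eq_part mxE; case: eqP => //; lia.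
Qed.

Lemma le_part_mul v i j (w : 'rV_(r i.+1)) :
  (w <= le_part i.+1 j)%MS -> (w *m C v i <= le_part i j)%MS.
Proof.
move=> /le_partP w0; apply/le_partP => b jb; rewrite mxE big1 // => a _.
have [aj|/w0->] := leP (d a) j; last by rewrite mul0r.
by rewrite C_filt ?mulr0 //; apply: le_lt_trans jb.
Qed.

(** In the target degree [j], contributions from sources of smaller degree vanish by the filtration
    condition, and those from degree [j] are exactly the entries of [T]. *)
Lemma eq_part_mul v i j (w : 'rV_(r i.+1)) : (w <= le_part i.+1 j)%MS ->
  (w *m C v i) *m eq_part i j = (w *m eq_part i.+1 j) *m T i.
Proof.
move=> /le_partP w0; apply/rowP => b; rewrite mul_eq_part !mxE.
case: eqP => [bj|bj].
  apply: eq_bigr => a _; rewrite mul_eq_part (T_def v) bj.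
  have [aj|/w0->|//] := ltgtP (d a) j; rewrite !mul0r //.
  by rewrite C_filt ?mulr0 // bj.
rewrite big1 // => a _; rewrite mul_eq_part (T_def v).
by case: eqP => [->|_]; rewrite ?mul0r // ifN ?mulr0 // eq_sym; apply/eqP.
Qed.

Lemma eq_part_mulT i j (w : 'rV_(r i.+1)) :
  (w <= eq_part i.+1 j)%MS -> (w *m T i <= eq_part i j)%MS.
Proof.
move=> wj; rewrite -[w in w *m _](eq_part_id wj) -(eq_part_mul 0 (eq_part_le wj)).
exact: submxMl.
Qed.

Lemma homog_triple_lin i j a (w w' : 'I_3 -> 'rV_(r i)) :
  homog_triple j w -> homog_triple j w' ->
  homog_triple j (fun v => a *: w v + w' v).
Proof.
move=> [wl we] [wl' we']; split=> v; first by rewrite addmx_sub // scalemx_sub.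
by rewrite !mulmxDl -!scalemxAl we we'.
Qed.

Lemma homog_tripleB i j (w w' : 'I_3 -> 'rV_(r i)) :
  homog_triple j w -> homog_triple j w' -> homog_triple j (fun v => w v - w' v).
Proof.
move=> hw hw'; have := homog_triple_lin (-1) hw' hw.
by congr homog_triple; apply/funext => v; rewrite scaleN1r addrC.
Qed.

Lemma homog_triple0 i j : homog_triple j (fun=> 0 : 'rV_(r i)).
Proof. by split=> v; rewrite ?sub0mx. Qed.

(** All parts in degree [j] are zero, so they agree: this is the inclusion of the three steps below
    [j] into the strand of homogeneous triples. *)
Lemma homog_triple_pred i j (w : 'I_3 -> 'rV_(r i)) :
  (forall v, w v <= le_part i (j - 1))%MS -> homog_triple j w.
Proof.
move=> hw; have w0 v : (w v <= le_part i j)%MS /\ w v *m eq_part i j = 0.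
  by move: (hw v); rewrite le_part_pred => /andP[-> /eqP].
by split=> v; case: (w0 v) => // _ ->; case: (w0 0).
Qed.

(* Cycles and boundaries, in position i.+1, of the degree j strand of the
   complex T and of the filtration step j of the complexes C v. *)
Definition cyclesT i j := (kermx (T i) :&: eq_part i.+1 j)%MS.
Definition boundsT i j := eq_part i.+2 j *m T i.+1.
Definition cyclesC v i j := (kermx (C v i) :&: le_part i.+1 j)%MS.
Definition boundsC v i j := le_part i.+2 j *m C v i.+1.

Lemma cyclesTP i j (w : 'rV_(r i.+1)) :
  reflect (w *m T i = 0 /\ (w <= eq_part i.+1 j)%MS) (w <= cyclesT i j)%MS.
Proof. by rewrite sub_capmx; apply: (iffP andP) => -[] /sub_kermxP. Qed.

Lemma cyclesCP v i j (w : 'rV_(r i.+1)) :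
  reflect (w *m C v i = 0 /\ (w <= le_part i.+1 j)%MS) (w <= cyclesC v i j)%MS.
Proof. by rewrite sub_capmx; apply: (iffP andP) => -[] /sub_kermxP. Qed.

Lemma boundsT_cycles i j : (boundsT i j <= cyclesT i j)%MS.
Proof.
apply/row_subP => a; apply/cyclesTP; rewrite row_mul; split.
  by rewrite -mulmxA T_sq mulmx0.
exact/eq_part_mulT/row_sub.
Qed.

Lemma boundsC_cycles v i j : (boundsC v i j <= cyclesC v i j)%MS.
Proof.
apply/row_subP => a; apply/cyclesCP; rewrite row_mul; split.
  by rewrite -mulmxA C_sq mulmx0.
exact/le_part_mul/row_sub.
Qed.

Definition hT i j := \rank (cyclesT i j :\: boundsT i j)%MS.
Definition hC v i j := \rank (cyclesC v i j :\: boundsC v i j)%MS.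

(** The connecting homomorphism of the first exact sequence, written as a relation so that no lift
    has to be chosen: [u] lifts [x], and [y] is its differential. *)
Definition connecting i j (x : 'I_1 -> 'rV[K]_(r i.+2)) (y : 'I_3 -> 'rV[K]_(r i.+1)) :=
  exists u, [/\ homog_triple j u, u 0 *m eq_part i.+2 j = x 0
    & forall v, y v = u v *m C v i.+1].

Lemma connecting0 i j : connecting j (fun=> 0 : 'rV_(r i.+2)) (fun=> 0).
Proof.
exists (fun=> 0); split; first exact: homog_triple0.
  by rewrite mul0mx.
by move=> v; rewrite mul0mx.
Qed.

Lemma connecting_lin i j a (x x' : 'I_1 -> 'rV_(r i.+2)) y y' :
  connecting j x y -> connecting j x' y' ->
  connecting j (fun i => a *: x i + x' i) (fun i => a *: y i + y' i).
Proof.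
move=> [u [hu xE yE]] [u' [hu' xE' yE']].
exists (fun v => a *: u v + u' v); split; first exact: homog_triple_lin.
  by rewrite mulmxDl -scalemxAl xE xE'.
by move=> v; rewrite yE yE' mulmxDl -scalemxAl.
Qed.

(** The homogeneous strand is acyclic in positive positions, so the connecting map is an
    isomorphism. Each inequality uses the same relation, read in one of the two directions. *)
Lemma hT_hC i j : hT i.+1 j = (\sum_v hC v i (j - 1))%N.
Proof.
transitivity (\sum_(l < 1) hT i.+1 j)%N; first by rewrite big_ord1.
rewrite /hT /hC; apply/eqP.
rewrite eqn_leq; apply/andP; split.
  apply: (@sum_rank_quotient_le _ _ _ _ _ _ _ _ _ _ _ (@connecting i j)).
  - by move=> _; apply: boundsT_cycles.
  - by move=> v; apply: boundsC_cycles.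
  - exact: connecting0.
  - by move=> a x y x' y'; apply: connecting_lin.
  (* A cycle of [T] is lifted to the triple with three equal components; its differential has no
     part in degree [j] and so drops to step [j - 1]. *)
  - move=> x xZ; have /cyclesTP[xT xj] := xZ 0.
    exists (fun v => x 0 *m C v i.+1) => [v|].
      apply/cyclesCP; split; first by rewrite -mulmxA C_sq mulmx0.
      rewrite le_part_pred le_part_mul ?eq_part_le // eq_part_mul ?eq_part_le //.
      by rewrite eq_part_id // xT eqxx.
    exists (fun=> x 0); split=> //; last exact: eq_part_id.
    by split=> v //; apply: eq_part_le.
  - move=> x y [u [hu xE yE]] yB l; rewrite (ord1 l) {l}.
    have /choice[q qP] v : exists q : 'rV_(r i.+2),
        (q <= le_part i.+2 (j - 1))%MS /\ y v = q *m C v i.+1.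
      by have /sub_mulmxP[q] := yB v; exists q.
    have hq : homog_triple j q by apply: homog_triple_pred => v; case: (qP v).
    (* Both [u] and [q] have differential [y], so [u - q] is a homogeneous cycle and thus a
       boundary; taking parts in degree [j], where [q] has none, bounds [x]. *)
    have [|w hw wE] := C_exact (homog_tripleB hu hq).
      by move=> v; rewrite mulmxBl -yE; case: (qP v) => _ <-; rewrite subrr.
    apply/sub_mulmxP; exists (w 0 *m eq_part i.+3 j); first exact: submxMl.
    rewrite -(eq_part_mul 0); last by case: hw.
    rewrite -wE mulmxBl xE; case: (qP 0) => + _.
    by rewrite le_part_pred => /andP[_ /eqP->]; rewrite subr0.
apply: (@sum_rank_quotient_le _ _ _ _ _ _ _ _ _ _ _ (fun y x => @connecting i j x y)).
- by move=> v; apply: boundsC_cycles.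
- by move=> _; apply: boundsT_cycles.
- exact: connecting0.
- by move=> a y x y' x'; apply: connecting_lin.
- move=> y yZ; have yC v : y v *m C v i = 0 by have /cyclesCP[] := yZ v.
  have hy : homog_triple j y.
    by apply: homog_triple_pred => v; have /cyclesCP[] := yZ v.
  have [w hw wE] := C_exact hy yC.
  exists (fun=> w 0 *m eq_part i.+2 j); last by exists w.
  move=> _; apply/cyclesTP; split; last exact: submxMl.
  rewrite -(eq_part_mul 0); last by case: hw.
  rewrite -wE; have /cyclesCP[_] := yZ 0.
  by rewrite le_part_pred => /andP[_ /eqP].
- move=> y x [u [[ul ue] xE yE]] xB v.
  have /sub_mulmxP[s sj sE] := xB 0.
  (* Subtracting a boundary keeps the differential of [u v] and cancels its part in degree [j]. *)
  apply/sub_mulmxP; exists (u v - s *m C v i.+2).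
    rewrite le_part_pred submxB ?ul ?le_part_mul ?(eq_part_le sj) //=.
    rewrite mulmxBl eq_part_mul ?eq_part_le // eq_part_id // ue xE sE.
    by rewrite subrr.
  by rewrite yE mulmxBl -[_ *m _ *m _]mulmxA C_sq mulmx0 subr0.
Qed.

(** The map to two copies of [T] in the second exact sequence: the parts in degree [j] on axes 1 and
    2 minus the one on axis 0. Its kernel consists of the homogeneous triples. *)
Definition top_diff i j (w : 'I_3 -> 'rV[K]_(r i.+1)) (s : 'I_2 -> 'rV[K]_(r i.+1)) :=
  (forall v, w v <= cyclesC v i j)%MS /\
  (forall l, s l = (w (lift 0 l) - w 0) *m eq_part i.+1 j).

Lemma top_diff0 i j : @top_diff i j (fun=> 0) (fun=> 0).
Proof. by split=> [v|l]; rewrite ?sub0mx // subrr mul0mx. Qed.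

Lemma top_diff_lin i j a w s w' s' : @top_diff i j w s -> @top_diff i j w' s' ->
  top_diff j (fun v => a *: w v + w' v) (fun l => a *: s l + s' l).
Proof.
move=> [wZ sE] [wZ' sE']; split=> [v|l]; first by rewrite addmx_sub // scalemx_sub.
by rewrite sE sE' scalemxAl -mulmxDl scalerBr opprD addrACA.
Qed.

Definition extend0 n (s : 'I_2 -> 'rV[K]_n) (v : 'I_3) :=
  if unlift 0 v is Some l then s l else 0.

Lemma cyclesC_top v i j (w : 'rV_(r i.+1)) :
  (w <= cyclesC v i j)%MS -> (w *m eq_part i.+1 j <= cyclesT i j)%MS.
Proof.
case/cyclesCP=> wC wj; apply/cyclesTP; split; last exact: submxMl.
by rewrite -(eq_part_mul v) // wC mul0mx.
Qed.

(** The map [top_diff] is injective on homology. If the differences bound [e], correcting [w] by the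
    differential of [extend0 e] gives a homogeneous cycle, which is a boundary by acyclicity. *)
Lemma hC_hT_le i j : (\sum_v hC v i j <= 2 * hT i j)%N.
Proof.
rewrite -[X in (X * _)%N](card_ord 2) -sum_nat_const.
apply: (@sum_rank_quotient_le _ _ _ _ _ _ _ _ _ _ _ (@top_diff i j)).
- by move=> v; apply: boundsC_cycles.
- by move=> _; apply: boundsT_cycles.
- exact: top_diff0.
- by move=> a w s w' s'; apply: top_diff_lin.
- move=> w wZ; exists (fun l => (w (lift 0 l) - w 0) *m eq_part i.+1 j) => // l.
  by rewrite mulmxBl submxB // (cyclesC_top (wZ _)).
- move=> w s [wZ sE] sB.
  have /choice[e eP] l : exists e : 'rV_(r i.+2),
      (e <= eq_part i.+2 j)%MS /\ s l = e *m T i.+1.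
    by have /sub_mulmxP[e] := sB l; exists e.
  pose q := extend0 e.
  have ql v : (q v <= eq_part i.+2 j)%MS.
    rewrite /q /extend0; case: unlift => [l|]; last exact: sub0mx.
    by case: (eP l).
  have qT v : w v *m eq_part i.+1 j - q v *m T i.+1 = w 0 *m eq_part i.+1 j.
    rewrite /q /extend0; case: unliftP => [l|] ->; last by rewrite mul0mx subr0.
    by case: (eP l) => _ <-; rewrite sE mulmxBl opprB addrC subrK.
  have hw : homog_triple j (fun v => w v - q v *m C v i.+1).
    have wE v : (w v - q v *m C v i.+1) *m eq_part i.+1 j = w 0 *m eq_part i.+1 j.
      by rewrite mulmxBl eq_part_mul ?eq_part_le // (eq_part_id (ql v)) qT.
    split=> v; last by rewrite !wE.
    have /cyclesCP[_ wl] := wZ v.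
    by rewrite submxB ?le_part_mul ?(eq_part_le (ql v)).
  have [|u [ul _] uE] := C_exact hw.
    move=> v; rewrite mulmxBl -mulmxA C_sq mulmx0 subr0.
    by have /cyclesCP[] := wZ v.
  move=> v; apply/sub_mulmxP; exists (u v + q v).
    by rewrite addmx_sub // eq_part_le.
  by rewrite mulmxDl -uE subrK.
Qed.

(** For surjectivity, [s] is lifted to [q]; the differential of [q] is a homogeneous cycle one
    position lower, hence the differential of a homogeneous [u], and [q - u] is a cycle with the
    same differences. Acyclicity at that lower position explains the index [i.+1]. *)
Lemma hC_hT i j : (\sum_v hC v i.+1 j = 2 * hT i.+1 j)%N.
Proof.
apply/eqP; rewrite eqn_leq hC_hT_le /=.
rewrite -[X in (X * _)%N](card_ord 2) -sum_nat_const.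
apply: (@sum_rank_quotient_le _ _ _ _ _ _ _ _ _ _ _ (fun s w => @top_diff i.+1 j w s)).
- by move=> _; apply: boundsT_cycles.
- by move=> v; apply: boundsC_cycles.
- exact: top_diff0.
- by move=> a s w s' w'; apply: top_diff_lin.
- move=> s sZ; pose q := extend0 s.
  have qZ v : (q v <= cyclesT i.+1 j)%MS.
    by rewrite /q /extend0; case: unlift => [l|]; rewrite ?sub0mx.
  have ql v : (q v <= eq_part i.+2 j)%MS by have /cyclesTP[] := qZ v.
  have qle v : (q v <= le_part i.+2 j)%MS by apply: eq_part_le.
  have hy : homog_triple j (fun v => q v *m C v i.+1).
    have yE v : q v *m C v i.+1 *m eq_part i.+1 j = 0.
      by rewrite eq_part_mul // eq_part_id //; have /cyclesTP[] := qZ v.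
    by split=> v; rewrite ?yE ?le_part_mul.
  have [|u [ul ue] uE] := C_exact hy.
    by move=> v; rewrite -mulmxA C_sq mulmx0.
  have wZ v : (q v - u v <= cyclesC v i.+1 j)%MS.
    apply/cyclesCP; split; first by rewrite mulmxBl -uE subrr.
    exact: submxB.
  exists (fun v => q v - u v) => //; split=> // l.
  rewrite mulmxBl !mulmxBl !ue !(eq_part_id (ql _)) /q /extend0 liftK unlift_none.
  by rewrite sub0r opprK subrK.
- move=> s w [wZ sE] wB l.
  have /choice[e eP] v : exists e : 'rV_(r i.+3),
      (e <= le_part i.+3 j)%MS /\ w v = e *m C v i.+2.
    by have /sub_mulmxP[e] := wB v; exists e.
  have eE v : w v *m eq_part i.+2 j = e v *m eq_part i.+3 j *m T i.+2.
    by case: (eP v) => el ->; rewrite eq_part_mul.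
  apply/sub_mulmxP; exists ((e (lift 0 l) - e 0) *m eq_part i.+3 j).
    exact: submxMl.
  by rewrite sE !mulmxBl !eE.
Qed.

(** * The rank count behind the inequality for [gamma] *)

Lemma rank_le_part i j :
  \rank (le_part i j) = (\rank (le_part i (j - 1)) + \rank (eq_part i j))%N.
Proof.
rewrite -(mxrank_mul_ker (le_part i j) (eq_part i j)) addnC; congr (_ + _)%N.
  apply: eqmx_rank; apply/andP; split; apply/row_subP => a.
    have := row_sub a (le_part i j :&: kermx (eq_part i j))%MS.
    by rewrite sub_capmx => /andP[? /sub_kermxP/eqP]; rewrite le_part_pred => ->; rewrite andbT.
  have := row_sub a (le_part i (j - 1)).
  rewrite le_part_pred sub_capmx => /andP[-> /eqP ?]; exact/sub_kermxP.
congr (\rank _); rewrite mul_mx_diag; apply/matrixP => a b; rewrite !mxE.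
case: (eqVneq a b) => [<-|_]; last by rewrite !mulr0n mul0r.
by rewrite !mulr1n; case: eqP => [->|]; rewrite ?lexx ?mulr1 ?mulr0.
Qed.

(** Rank-nullity for the projection to degree [j], restricted to the image of [C v i]: the kernel
    lies in step [j - 1] and the image comes from [T]. *)
Lemma rank_image v i j : (\rank (le_part i.+1 j *m C v i) <=
  \rank (le_part i.+1 j *m C v i :&: le_part i (j - 1))%MS
  + \rank (eq_part i.+1 j *m T i))%N.
Proof.
set A := _ *m C v i.
have Arow a : (row a A <= le_part i j)%MS by rewrite row_mul le_part_mul ?row_sub.
rewrite -(mxrank_mul_ker A (eq_part i j)) addnC leq_add //; apply: mxrankS.
  apply/rV_subP => w; rewrite !sub_capmx => /andP[wA /sub_kermxP/eqP wj].
  rewrite wA le_part_pred wj andbT.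
  by apply: submx_trans wA _; apply/row_subP.
apply/row_subP => a; rewrite row_mul row_mul eq_part_mul ?row_sub //.
by apply/sub_mulmxP; exists (row a (le_part i.+1 j) *m eq_part i.+1 j); rewrite ?submxMl.
Qed.

Definition h0 j := \rank (eq_part 0 j :\: (eq_part 1 j *m T 0))%MS.

(** By [rank_image] this is at least the codimension, in step [j - 1] of position 0, of the
    boundaries from step [j] that fall into it; hence it is nonnegative. *)
Definition excess v j : int := (\rank (le_part 0 (j - 1)))%:Z
  + (\rank (eq_part 1 j *m T 0))%:Z - (\rank (le_part 1 j *m C v 0))%:Z.

Lemma excess_ge0 v j : 0 <= excess v j.
Proof.
have := rank_image v 0 j; have := mxrankS (capmxSr (le_part 1 j *m C v 0) (le_part 0 (j - 1))).
rewrite /excess; do ![move: (\rank _) => ?]; lia.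
Qed.

(** After rank-nullity in positions 0 and 1 the only loss is in [im1] and [im2]: boundaries from
    position 2 that drop to step [j - 1] are cycles there. *)
Lemma excess_diff v j : excess v j - excess v (j - 1) <=
  (h0 (j - 1))%:Z - (hT 0 j)%:Z + (hC v 0 j)%:Z.
Proof.
have t0 := rank_quotient (boundsT_cycles 0 j).
have c0 := rank_quotient (boundsC_cycles v 0 j).
have e0 : (eq_part 1 (j - 1) *m T 0 <= eq_part 0 (j - 1))%MS.
  by apply/row_subP => a; rewrite row_mul eq_part_mulT ?row_sub.
have {}e0 := rank_quotient e0.
have kT := mxrank_mul_ker (eq_part 1 j) (T 0).
have kC := mxrank_mul_ker (le_part 1 j) (C v 0).
have kC' := mxrank_mul_ker (le_part 1 (j - 1)) (C v 0).
have im1 := rank_image v 1 j.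
have im2 : (\rank (le_part 2 j *m C v 1 :&: le_part 1 (j - 1)) <=
    \rank (le_part 1 (j - 1) :&: kermx (C v 0)))%N.
  apply/mxrankS/rV_subP => w; rewrite !sub_capmx => /andP[wB ->] /=.
  by apply/sub_kermxP; have /cyclesCP[] := submx_trans wB (boundsC_cycles v 0 j).
have l0 := rank_le_part 0 (j - 1).
have l1 := rank_le_part 1 j.
move: t0 c0; rewrite /cyclesT /cyclesC ![(kermx _ :&: _)%MS]capmxC.
rewrite /excess /h0 /hT /hC /boundsT /boundsC /cyclesT /cyclesC.
rewrite ![(kermx _ :&: _)%MS]capmxC; move: e0 kT kC kC' im1 im2 l0 l1.
do ![move: (\rank _) => ?]; lia.
Qed.

Lemma excess_low v j : (forall a : 'I_(r 0), j < d a) -> excess v j <= 0.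
Proof.
move=> lo; have l0 j' : j' <= j -> \rank (le_part 0 j') = 0%N.
  move=> j'j; apply/eqP; rewrite mxrank_eq0; apply/rowV0P => w /le_partP w0.
  by apply/rowP => a; rewrite mxE w0 //; apply: le_lt_trans (lo a).
have t0 : (\rank (eq_part 1 j *m T 0) <= \rank (le_part 0 j))%N.
  by apply/mxrankS/row_subP => a; rewrite row_mul eq_part_le ?eq_part_mulT ?row_sub.
rewrite /excess (l0 (j - 1)); last by lia.
by move: t0; rewrite (l0 j) // leqn0 => /eqP->; rewrite add0r; lia.
Qed.

End FilteredComplex.

(** * Homogeneous row vectors over [B] and homogeneous triples of scalar vectors *)

Section GradedVectors.
Variable k : fieldType.

Definition homog_row n (d : 'I_n -> int) (j : int) (w : 'rV[B k]_n) :=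
  forall a, Bhomog (j - d a) (w 0 a).

Definition row_comp n (d : 'I_n -> int) (j : int) (w : 'rV[B k]_n) : 'rV[B k]_n :=
  \row_a Bcomp (j - d a) (w 0 a).

Lemma row_comp_homog n (d : 'I_n -> int) j w : homog_row d j (row_comp d j w).
Proof. by move=> a; rewrite mxE; apply: Bcomp_homog. Qed.

Lemma row_comp_is_zmod_morphism n (d : 'I_n -> int) j :
  zmod_morphism (row_comp d j).
Proof. by move=> w w'; apply/rowP => a; rewrite !mxE raddfB. Qed.

HB.instance Definition _ n (d : 'I_n -> int) j :=
  GRing.isZmodMorphism.Build 'rV[B k]_n 'rV[B k]_n (row_comp d j)
    (row_comp_is_zmod_morphism d j).

Lemma row_comp_id n (d : 'I_n -> int) i j w :
  homog_row d i w -> row_comp d j w = if j == i then w else 0.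
Proof.
move=> hw; apply/rowP => a; rewrite !mxE (Bcomp_id _ (hw a)).
by rewrite (inj_eq (addIr _)); case: eqP; rewrite ?mxE.
Qed.

Section Matrix.
Variables (m n : nat) (d : 'I_m -> int) (e : 'I_n -> int) (D : 'M[B k]_(m, n)).
Hypothesis D_homog : forall a b, Bhomog (d a - e b) (D a b).

Lemma row_comp_mul j w : row_comp e j (w *m D) = row_comp d j w *m D.
Proof.
apply/rowP => b; rewrite !mxE raddf_sum; apply: eq_bigr => a _ /=.
by rewrite (BcompM _ _ (D_homog a b)) mxE opprB addrA subrK.
Qed.

Lemma homog_row_mul j w : homog_row d j w -> homog_row e j (w *m D).
Proof.
move=> hw b; rewrite mxE; apply: Bhomog_sum => a.
by have := BhomogM (hw a) (D_homog a b); rewrite addrA subrK.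
Qed.

End Matrix.

Lemma Bhomog_eq0 d (b : B k) : Bhomog d b -> (forall v, axis1 v b = 0) -> b = 0.
Proof.
case: d => [n hb b0|n]; last by [].
by apply: axis_ext => v; rewrite (Bhomog_axis1 v hb) b0 mul0r rmorph0.
Qed.

Lemma homog_row_eq0 n (d : 'I_n -> int) j w : homog_row d j w ->
  (forall v, map_mx (axis1 v) w = 0) -> w = 0.
Proof.
move=> hw w0; apply/rowP => a; rewrite [RHS]mxE; apply: (Bhomog_eq0 (hw a)) => v.
by have /rowP/(_ a) := w0 v; rewrite !mxE.
Qed.

Variables (r : nat -> nat) (d : forall i, 'I_(r i) -> int).

Lemma homog_row_triple i j w : homog_row (@d i) j w ->
  homog_triple d j (fun v => map_mx (axis1 v) w).
Proof.
move=> hw; split=> v.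
  by apply/le_partP => a ja; rewrite mxE (axis1_lt0 _ _ (hw a)) // subr_lt0.
apply/rowP => a; rewrite !mul_eq_part; case: eqP => // aj.
have := hw a; rewrite aj subrr !mxE => hwa.
by have := Baug_homog v hwa; rewrite (Baug_homog 0 hwa) eqxx => ->.
Qed.

(** Entries are built with [Btriple]. An entry of degree 0 occurs where [d a = j], and there the
    agreement of the three vectors supplies the required constant triple. *)
Lemma homog_triple_row i j w : @homog_triple k r d i j w ->
  exists2 W, homog_row (@d i) j W & forall v, map_mx (axis1 v) W = w v.
Proof.
move=> [wl we].
exists (\row_a if j - d a is Posz n then Btriple n (fun v => w v 0 a) else 0).
  move=> a; rewrite mxE; case: (j - d a) => [n|n] //; exact: Btriple_homog.
move=> v; apply/rowP => a; rewrite !mxE.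
case E : (j - d a) => [n|n]; last first.
  by rewrite rmorph0; have /le_partP-> // := wl v; rewrite -subr_lt0 E.
rewrite /axis1 axis_triple => [|n0 u].
  by rewrite hornerM hornerC hornerXn expr1n mulr1.
have dj : d a == j by rewrite eq_sym -subr_eq0 E n0.
by have /rowP/(_ a) := we u; rewrite !mul_eq_part dj.
Qed.

End GradedVectors.

(** * Relations between the Betti numbers of a resolution *)

Section BettiFacet.
Variables (k : fieldType) (M : graded_module k) (F : free_resolution M).
Local Notation r := (fr_rank F).
Local Notation d := (fr_deg F).
Local Notation C := (fun v i => map_mx (@axis1 k v) (fr_diff F i)).
Local Notation T := (tens_diff F).

Lemma fr_diff_sq i : fr_diff F i.+1 *m fr_diff F i = 0.
Proof.
apply/row_matrixP => a; rewrite row_mul row0.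
by apply/fr_exact; exists (delta_mx 0 a); rewrite -rowE.
Qed.

Lemma res_filt v i (a : 'I_(r i.+1)) (b : 'I_(r i)) :
  d i.+1 a < d i b -> C v i a b = 0.
Proof.
by move=> ab; rewrite mxE (axis1_lt0 _ _ (fr_diff_homog a b)) // subr_lt0.
Qed.

Lemma res_top v i (a : 'I_(r i.+1)) (b : 'I_(r i)) :
  T i a b = if d i.+1 a == d i b then C v i a b else 0.
Proof. by rewrite !mxE (Baug_homog v (fr_diff_homog a b)) subr_eq0. Qed.

Lemma res_sq v i : C v i.+1 *m C v i = 0.
Proof. by rewrite -map_mxM fr_diff_sq map_mx0. Qed.

Lemma res_top_sq i : T i.+1 *m T i = 0.
Proof. by rewrite /tens_diff -map_mxM fr_diff_sq map_mx0. Qed.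

(** A preimage over [B] need not be homogeneous; its component of degree [j] is still a preimage
    because the differential is homogeneous. *)
Lemma res_exact i j (w : 'I_3 -> 'rV[k]_(r i.+1)) :
  homog_triple d j w -> (forall v, w v *m C v i = 0) ->
  exists2 w', homog_triple d j w' & forall v, w v = w' v *m C v i.+1.
Proof.
move=> /homog_triple_row[W hW WE] wC.
have dh i' := @fr_diff_homog _ _ F i'.
have /fr_exact[W' W'E] : W *m fr_diff F i = 0.
  apply: (homog_row_eq0 (homog_row_mul (dh i) hW)) => v.
  by rewrite map_mxM WE wC.
exists (fun v => map_mx (axis1 v) (row_comp (d i.+2) j W')).
  by apply: homog_row_triple; apply: row_comp_homog.
move=> v; rewrite -map_mxM -(row_comp_mul (dh i.+1)) -W'E (row_comp_id j hW).
by rewrite eqxx WE.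
Qed.

Lemma dim_Tor0 j : dim_Tor F 0 j = h0 d T j.
Proof. by rewrite /dim_Tor cap1mx. Qed.

Lemma dim_TorS i j : dim_Tor F i.+1 j = hT d T i j.
Proof. by []. Qed.

Let sum_hC i j : (\sum_v hC d C v i (j - 1) = dim_Tor F i.+2 j)%N.
Proof.
by rewrite dim_TorS (hT_hC res_filt res_top res_sq res_top_sq res_exact).
Qed.

Lemma dim_Tor_double i j : (2 <= i)%N ->
  dim_Tor F i.+1 (j + 1) = (2 * dim_Tor F i j)%N.
Proof.
case: i => [|[|i]] // _; rewrite -sum_hC addrK.
by rewrite (hC_hT res_filt res_top res_sq res_top_sq res_exact).
Qed.

Lemma dim_Tor2_le j : (dim_Tor F 2 (j + 1) <= 2 * dim_Tor F 1 j)%N.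
Proof.
rewrite -sum_hC addrK.
exact: (hC_hT_le res_filt res_top res_sq res_top_sq res_exact).
Qed.

(** Sum of [excess_diff] over the three axes, where [sum_hC] turns the homology of the [C v] in step
    [j + 1] into Tor in position 2 and degree [j + 2]. *)
Lemma dim_Tor_excess j :
  (\sum_v excess d C T v (j + 1))%R - (\sum_v excess d C T v j)%R <=
  3 * (dim_Tor F 0 j)%:Z - 3 * (dim_Tor F 1 (j + 1))%:Z
  + (dim_Tor F 2 (j + 2))%:Z.
Proof.
have eD v : excess d C T v (j + 1) - excess d C T v j <=
    (h0 d T j)%:Z - (hT d T 0 (j + 1))%:Z + (hC d C v 0 (j + 1))%:Z.
  by have := excess_diff res_filt res_top res_sq res_top_sq v (j + 1); rewrite addrK.
rewrite -sumrB.
apply: le_trans (ler_sum _ (fun v _ => eD v)) _.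
rewrite big_split sumr_const /= card_ord -dim_Tor0 -dim_TorS.
have := sum_hC 0 (j + 1 + 1); rewrite addrK -addrA -[1 + 1]/2 => <-.
rewrite -(big_morph Posz PoszD (erefl (Posz 0))) /=.
by move: (\sum_(i < 3) _)%N (dim_Tor F 0 j) (dim_Tor F 1 _); lia.
Qed.

Lemma dim_Tor_support i j : dim_Tor F i j != 0%N -> j \in codom (fr_deg F i).
Proof.
apply: contraR => jd; rewrite -leqn0.
apply: leq_trans (mxrankS (diffmxSl _ _)) _.
apply: leq_trans (mxrankS (capmxSr _ _)) _.
rewrite leqn0 mxrank_eq0; apply/eqP/matrixP => a b; rewrite !mxE.
case: eqP => [aj|_]; last by rewrite mul0rn.
by case/negP: jd; rewrite -aj codom_f.
Qed.

End BettiFacet.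

(** * Closure properties of cones *)

Section ConeSpan.
Variable S : set table.

Lemma cone_span_eq (v w : table) :
  (forall i j, v i j = w i j) -> cone_span S v -> cone_span S w.
Proof.
by move=> vw [n [c [t [c0 St vE]]]]; exists n, c, t; split=> // i j; rewrite -vw.
Qed.

Lemma cone_span0 : cone_span S (fun _ _ => 0).
Proof.
by exists 0%N, (fun=> 0), (fun=> fun _ _ => 0); split=> [[]//|[]//|i j]; rewrite big_ord0.
Qed.

Lemma cone_spanD (v w : table) : cone_span S v -> cone_span S w ->
  cone_span S (fun i j => v i j + w i j).
Proof.
move=> [n [c [t [c0 St vE]]]] [n' [c' [t' [c0' St' wE]]]].
exists (n + n')%N, (fun l => match fintype.split l with inl x => c x | inr y => c' y end),
  (fun l => match fintype.split l with inl x => t x | inr y => t' y end); split=> [l|l|i j].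
- by case: fintype.split.
- by case: fintype.split.
rewrite vE wE big_split_ord; congr (_ + _); apply: eq_bigr => l _.
  by rewrite (unsplitK (inl l)).
by rewrite (unsplitK (inr l)).
Qed.

Lemma cone_spanZ a (v : table) : 0 <= a -> cone_span S v ->
  cone_span S (fun i j => a * v i j).
Proof.
move=> a0 [n [c [t [c0 St vE]]]]; exists n, (fun l => a * c l), t.
split=> // [l|i j]; first exact: mulr_ge0.
by rewrite vE mulr_sumr; apply: eq_bigr => l _; rewrite mulrA.
Qed.

Lemma cone_span_sum n (v : 'I_n -> table) : (forall l, cone_span S (v l)) ->
  cone_span S (fun i j => \sum_l v l i j).
Proof.
elim: n v => [|n IHn] v Sv.
  by apply: cone_span_eq cone_span0 => i j; rewrite big_ord0.
apply: cone_span_eq (cone_spanD (IHn _ (fun l => Sv (widen_ord (leqnSn n) l))) (Sv ord_max)).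
by move=> i j; rewrite big_ord_recr.
Qed.

Lemma cone_span_id (v : table) : S v -> cone_span S v.
Proof.
by move=> Sv; exists 1%N, (fun=> 1), (fun=> v); split=> // i j; rewrite big_ord1 mul1r.
Qed.

End ConeSpan.

Lemma cone_span_sub (S S' : set table) :
  S `<=` cone_span S' -> cone_span S `<=` cone_span S'.
Proof.
move=> SS' v [n [c [t [c0 St vE]]]].
apply: cone_span_eq (cone_span_sum (fun l => cone_spanZ (c0 l) (SS' _ (St l)))).
by move=> i j; rewrite vE.
Qed.

(** * The functional [gamma] as a finite sum, and the Betti cone inside the facet cone *)

Section Gamma.
Implicit Types v : table.

Definition gamma_term v (j : int) : rat :=
  3 * v 0%N j - 3 * v 1%N (j + 1) + v 2%N (j + 2).

Lemma gammaE (lo : int) (n : nat) v : (forall j, j < lo -> gamma_term v j = 0) ->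
  gamma (lo + n%:Z) v = \sum_(m < n.+1) gamma_term v (lo + m%:Z).
Proof.
move=> v0; pose s := [seq lo + m%:Z | m <- iota 0 n.+1].
have us : uniq s by rewrite map_inj_uniq ?iota_uniq // => x y /addrI[].
rewrite -(big_mkord predT (fun m => gamma_term v (lo + m%:Z))) /index_iota subn0.
transitivity (\sum_(j <- s) gamma_term v j); last by rewrite big_map.
rewrite fsbig_seq //; apply/esym/fsbig_widen => j /=.
  by case/mapP => m; rewrite mem_iota => /andP[_ mn] ->; lia.
move=> [jn js]; apply: v0; rewrite ltNge; apply/negP => loj; apply: js.
by apply/mapP; exists `|j - lo|%N; [rewrite mem_iota|]; lia.
Qed.

Lemma V_bound v : V v ->
  exists N : nat, forall i j, (i <= 2)%N -> (N < `|j|)%N -> v i j = 0.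
Proof.
move=> Vv; have rowN i : exists N : nat, forall j, (N < `|j|)%N -> v i j = 0.
  have /finite_seqP[s sE] := Vv i.
  exists (\sum_(j <- s) `|j|)%N => j; apply: contraTeq => vj.
  have js : j \in s by have : [set` s] j by rewrite -sE.
  by rewrite -leqNgt (big_rem j) //= leq_addr.
have /choice[N NE] := rowN; exists (N 0 + N 1 + N 2)%N => i j i2 Nj.
by apply: NE; apply: leq_ltn_trans Nj; case: i i2 => [|[|[|//]]] _; lia.
Qed.

Lemma gamma_term_low v N : (forall i j, (i <= 2)%N -> (N < `|j|)%N -> v i j = 0) ->
  forall j, j < - N%:Z - 2 -> gamma_term v j = 0.
Proof.
by move=> v0 j jN; rewrite /gamma_term !v0 ?mulr0 ?subrr ?addr0 //; lia.
Qed.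

Lemma facet_cone_span v : cone_span facet_cone v -> facet_cone v.
Proof.
move=> [n [c [t [c0 tF vE]]]].
have tV l : V (t l) by case: (tF l).
split.
- move=> i; apply: (@sub_finite_set _ _
    (\bigcup_(l in [set: 'I_n]) [set j | t l i j != 0])).
    move=> j /=; rewrite vE => /eqP vj; apply: contrapT => tj; apply: vj.
    apply: big1 => l _; have [->|tlj] := eqVneq (t l i j) 0; rewrite ?mulr0 //.
    by exfalso; apply: tj; exists l.
  by apply: bigcup_finite => // l _; apply: tV.
- move=> i j; rewrite /epsilon vE sumr_ge0 // => l _; rewrite mulr_ge0 //.
  by have [_ tge0 _ _ _] := tF l; apply: tge0.
- move=> j; rewrite /alpha /epsilon !vE mulr_sumr -sumrB sumr_ge0 // => l _.
  have [_ _ /(_ j) + _ _] := tF l; rewrite /alpha /epsilon => al.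
  by rewrite mulrCA -mulrBr mulr_ge0.
- move=> j; have /choice[N NE] l := V_bound (tV l).
  (* A cutoff common to all tables [t l]; the term in [j] ensures [lo <= j]. *)
  pose N' := ((\sum_l N l) + `|j|)%N; pose lo := - N'%:Z - 2.
  have lowN l j' : j' < lo -> gamma_term (t l) j' = 0.
    move=> j'lo; apply: gamma_term_low (NE l) _ _.
    by move: j'lo; rewrite /lo /N' (bigD1 l) //=; lia.
  have gE v' : (forall j', j' < lo -> gamma_term v' j' = 0) -> gamma j v' =
      \sum_(m < (`|j - lo|.+1)%N) gamma_term v' (lo + m%:Z).
    by move=> ?; rewrite -gammaE //; congr (gamma _ _); lia.
  have gtE j' : gamma_term v j' = \sum_l c l * gamma_term (t l) j'.
    rewrite /gamma_term !vE !mulr_sumr -sumrB -big_split; apply: eq_bigr => l _ /=.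
    ring.
  rewrite gE => [|j' /lowN t0]; last by rewrite gtE big1 // => l _; rewrite t0 mulr0.
  under eq_bigr do rewrite gtE.
  rewrite exchange_big sumr_ge0 //= => l _; rewrite -mulr_sumr mulr_ge0 //.
  by rewrite -gE; [have [_ _ _ tg _] := tF l; apply: tg | apply: lowN].
- move=> i j i2; rewrite /epsilon !vE mulr_sumr; apply: eq_bigr => l _.
  have [_ _ _ _ /(_ i j i2)] := tF l; rewrite /epsilon => <-.
  by rewrite mulrCA.
Qed.

Lemma betti_facet (k : fieldType) (M : graded_module k) v :
  is_betti_table M v -> facet_cone v.
Proof.
move=> [F vE]; have vV : V v.
  move=> i; apply: (@sub_finite_set _ _ [set` codom (fr_deg F i)]) => //= j.
  by rewrite /= vE pnatr_eq0; apply: dim_Tor_support.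
split=> //.
- by move=> i j; rewrite /epsilon vE ler0n.
- move=> j; rewrite /alpha /epsilon !vE subr_ge0 -natrM ler_nat.
  exact: dim_Tor2_le.
- move=> j; have [N NE] := V_bound vV.
  (* Including the degrees of the generators in position 0 puts them all above [lo], where the
     excess is then nonpositive. *)
  pose N' := (N + (\sum_a `|fr_deg F 0 a|) + `|j|)%N; pose lo := - N'%:Z - 2.
  have -> : j = lo + `|j - lo|%:Z by rewrite /lo /N'; lia.
  rewrite gammaE => [|j' j'lo]; last first.
    by apply: gamma_term_low NE _ _; move: j'lo; rewrite /lo /N'; lia.
  pose E j := \sum_u excess (fr_deg F)
    (fun u i => map_mx (@axis1 k u) (fr_diff F i)) (tens_diff F) u j.
  have E0 j' : 0 <= E j'.
    by rewrite sumr_ge0 // => u _; apply: (excess_ge0 (@res_filt _ _ F) (@res_top _ _ F)).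
  have Elo : E lo <= 0.
    rewrite -oppr_ge0 -sumrN sumr_ge0 // => u _; rewrite oppr_ge0.
    apply: (excess_low (@res_filt _ _ F) (@res_top _ _ F)) => a.
    by rewrite /lo /N' (bigD1 a) //=; lia.
  have gE m : (E (lo + m.+1%:Z) - E (lo + m%:Z))%:~R <= gamma_term v (lo + m%:Z).
    have := @dim_Tor_excess _ _ F (lo + m%:Z).
    rewrite -(ler_int rat) /gamma_term !vE.
    have -> : lo + m.+1%:Z = lo + m%:Z + 1 by lia.
    rewrite -[E _ - E _]/(\sum_u _ - \sum_u _).
    by move/le_trans; apply; rewrite !(rmorphD, rmorphB, rmorphN, rmorphM) /= -!pmulrn.
  (* The lower bound telescopes to a final excess, which is nonnegative, minus the initial one,
     which is nonpositive. *)
  apply: (@le_trans _ _ (\sum_(m < `|j - lo|.+1)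
    (E (lo + m.+1%:Z) - E (lo + m%:Z))%:~R)); last by apply: ler_sum.
  rewrite -rmorph_sum /= ler0z -(big_mkord predT (fun m => E (lo + m.+1%:Z) - E (lo + m%:Z))).
  by rewrite telescope_sumr // addr0; move: (E0 (lo + `|j - lo|.+1%:Z)) Elo; lra.
- by move=> i j i2; rewrite /epsilon !vE -natrM dim_Tor_double.
Qed.

End Gamma.

(** * Decomposing tables of the facet cone into pure tables *)

Section Transport.
Variable lo : int.

Definition ext_seq (f : nat -> rat) (j : int) : rat :=
  if j - lo is Posz m then f m else 0.

(* The combination of the tables of (lo + m), (lo + m, lo + p) and
   (lo + m, lo + p, lo + p + 1, ...) having first row a and involving
   (lo + m, lo + p) with total weight t p and the infinite sequences through
   lo + p with total weight s p. *)
Definition mix_table (a t s : nat -> rat) : table := fun i j =>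
  if i is i'.+1 then 3 * 2 ^+ i' * ext_seq s (j - i'%:Z) + (i' == 0)%:R * ext_seq t j
  else ext_seq a j.

Definition delta (p n : nat) : rat := (n == p)%:R.

Lemma ext_delta p j : ext_seq (delta p) j = (j == lo + p%:Z)%:R.
Proof.
rewrite /ext_seq /delta; case E : (j - lo) => [m|m].
  by congr (_%:R : rat); lia.
by case: eqP => // ?; lia.
Qed.

Lemma pure_tableE d i j : pure_table d i j =
  if degseq_nth d i is Some j' then (j == j')%:R * pure_coef d i else 0.
Proof.
rewrite /pure_table; case: degseq_nth => [j'|//].
rewrite -[Some j' == Some j]/(j' == j) eq_sym.
by case: eqP; rewrite ?mul1r ?mul0r.
Qed.

Lemma degree_cone_free m : degree_cone (mix_table (delta m) (fun=> 0) (fun=> 0)).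
Proof.
apply: cone_span_eq (cone_span_id _); last by exists (DegFree (lo + m%:Z)).
move=> [|i] j; rewrite pure_tableE /= ?ext_delta ?mulr1 //.
by rewrite /ext_seq; do 2!case: (_ - lo) => ?; rewrite ?mulr0 ?addr0.
Qed.

Lemma ext_seq0 j : ext_seq (fun=> 0) j = 0.
Proof. by rewrite /ext_seq; case: (_ - lo). Qed.

Lemma degree_cone_fin m p : (m < p)%N ->
  degree_cone (mix_table (delta m) (delta p) (fun=> 0)).
Proof.
move=> mp; have lt_mp : lo + m%:Z < lo + p%:Z by lia.
apply: cone_span_eq (cone_span_id _); last by exists (DegFin lt_mp).
move=> [|[|i]] j; rewrite pure_tableE /= ?ext_delta ?ext_seq0 ?mulr1 //.
  by rewrite mulr0 add0r mul1r.
by rewrite mulr0 mul0r addr0.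
Qed.

Lemma degree_cone_inf m p : (m < p)%N ->
  degree_cone (mix_table (delta m) (fun=> 0) (delta p)).
Proof.
move=> mp; have lt_mp : lo + m%:Z < lo + p%:Z by lia.
apply: cone_span_eq (cone_span_id _); last by exists (DegInf lt_mp).
move=> [|i] j; rewrite pure_tableE /= ?ext_delta ?ext_seq0 ?mulr1 //.
by rewrite mulr0 addr0 mulrC subr_eq.
Qed.

Lemma sum_delta L (a : nat -> rat) m :
  \sum_(l < L) a l * delta l m = if (m < L)%N then a m else 0.
Proof.
case: ltnP => [mL|Lm].
  rewrite (bigD1 (Ordinal mL)) //= /delta eqxx mulr1 big1 ?addr0 // => l.
  by rewrite -val_eqE /= eq_sym => /negPf->; rewrite mulr0.
rewrite big1 // => l _; rewrite /delta gtn_eqF ?mulr0 //.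
exact: leq_trans (ltn_ord l) Lm.
Qed.

(* Demands are met in increasing order of p, each one proportionally from all
   the supply remaining below p. *)
Lemma degree_cone_mix L n p (a t s : nat -> rat) :
  (forall m, 0 <= a m) -> (forall m, 0 <= t m) -> (forall m, 0 <= s m) ->
  (forall m, (L <= m)%N -> a m = 0) ->
  (forall m, (m < p)%N || (p + n <= m)%N -> t m = 0 /\ s m = 0) ->
  (forall l, \sum_(m < l.+1) (t m + s m) <= \sum_(m < l) a m) ->
  degree_cone (mix_table a t s).
Proof.
elim: n p a t s => [|n IHn] p a t s a0 t0 s0 aL tsn supply.
  have ts m : t m = 0 /\ s m = 0 by apply: tsn; rewrite addn0; lia.
  apply: cone_span_eq (cone_span_sum (fun l : 'I_L =>
    cone_spanZ (a0 l) (degree_cone_free l))) => i j.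
  have -> : t = fun=> 0 by apply/funext => m; case: (ts m).
  have -> : s = fun=> 0 by apply/funext => m; case: (ts m).
  case: i => [|i] /=; last first.
    by rewrite !ext_seq0 !mulr0 addr0 big1 // => l _; rewrite mulr0.
  rewrite /ext_seq; case: (j - lo) => m; last by rewrite big1 // => l _; rewrite mulr0.
  by rewrite sum_delta; case: ltnP => // /aL.
pose A := \sum_(m < p) a m.
have A0 : 0 <= A by apply: sumr_ge0.
have tsA : t p + s p <= A.
  have := supply p; rewrite big_ord_recr /= big1 ?add0r // => m _.
  by have [|-> ->] := tsn m; rewrite ?ltn_ord ?addr0.
(* If [A = 0] then [A / A] is 0 by convention, but the demand [x] is then squeezed to 0 as well. *)
have low0 x y : 0 <= x -> 0 <= y -> x + y <= A -> A / A * x = x.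
  move=> x0 y0 xyA; have [A00|A00] := eqVneq A 0; last by rewrite divff ?mul1r.
  have -> : x = 0 by lra.
  by rewrite mulr0.
have tA : A / A * t p = t p by apply: low0 tsA.
have sA : A / A * s p = s p by apply: (low0 _ (t p)); rewrite // addrC.
(* The fraction taken from every supply below [p]; what remains is [a']. *)
pose q := (t p + s p) / A.
have q0 : 0 <= q by rewrite divr_ge0 // addr_ge0.
have q1 : q <= 1.
  have [A00|A00] := eqVneq A 0; first by rewrite /q A00 invr0 mulr0.
  by rewrite ler_pdivrMr ?mul1r // lt_def A00.
have AqE : A * q = t p + s p by rewrite /q mulrCA mulrDl [t p * _]mulrC [s p * _]mulrC tA sA.
pose a' m := if (m < p)%N then a m - q * a m else a m.
pose t' m := if m == p then 0 else t m.
pose s' m := if m == p then 0 else s m.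
have a'sum l : (p <= l)%N -> \sum_(m < l) a' m = \sum_(m < l) a m - (t p + s p).
  move=> pl; rewrite -AqE mulrC /A mulr_sumr.
  rewrite (big_ord_widen l (fun m => q * a m) pl) [X in _ - X]big_mkcond -sumrB.
  by apply: eq_bigr => m _; rewrite /a'; case: ifP; rewrite ?subr0.
have t'E l : \sum_(m < l) (t' m + s' m) =
    \sum_(m < l) (t m + s m) - (if (p < l)%N then t p + s p else 0).
  rewrite -(sum_delta l (fun=> t p + s p)) -sumrB; apply: eq_bigr => m _.
  rewrite /t' /s' /delta [p == _]eq_sym.
  by case: eqP => [->|_]; rewrite ?eqxx ?mulr1 ?mulr0 ?subr0 ?subrr ?addr0.
have IH : degree_cone (mix_table a' t' s').
  apply: (IHn p.+1).
  - move=> m; rewrite /a'; case: ifP => // _; rewrite -[X in X - _]mul1r -mulrBl.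
    by rewrite mulr_ge0 // subr_ge0.
  - by move=> m; rewrite /t'; case: ifP.
  - by move=> m; rewrite /s'; case: ifP.
  - by move=> m Lm; rewrite /a' (aL m Lm) mulr0 subr0 if_same.
  - move=> m hm; rewrite /t' /s'; case: eqP => // mp; apply: tsn; lia.
  (* Past [p], both sides lose the same amount [t p + s p]; up to [p], no demand is left. *)
  - move=> l; rewrite t'E; case: ltnP => pl; first by rewrite a'sum // lerD2r.
    rewrite subr0 big1 => [|m _].
      apply: sumr_ge0 => m _; rewrite /a'; case: ifP => // _.
      by rewrite -[X in X - _]mul1r -mulrBl mulr_ge0 // subr_ge0.
    by have [|-> ->] := tsn m; rewrite ?addr0 // (leq_trans (ltn_ord m) pl).
have wt (x : rat) (m : 'I_p) : 0 <= x -> 0 <= a m / A * x.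
  by move=> x0; rewrite mulr_ge0 // divr_ge0.
have used := cone_span_sum (fun m : 'I_p => cone_spanD
  (cone_spanZ (wt _ m (t0 p)) (degree_cone_fin (ltn_ord m)))
  (cone_spanZ (wt _ m (s0 p)) (degree_cone_inf (ltn_ord m)))).
apply: cone_span_eq (cone_spanD IH used) => i j /=.
case: i => [|i] /=.
  under eq_bigr do rewrite -mulrDl -mulrDr.
  rewrite /ext_seq; case: (j - lo) => m; last by rewrite big1 ?addr0 // => l _; rewrite mulr0.
  rewrite (sum_delta p (fun l => a l / A * (t p + s p))) /a' /q.
  by case: ltnP => _; rewrite ?addr0 //; ring.
have extE f j' : ext_seq f j' =
    ext_seq (fun m => if m == p then 0 else f m) j' + f p * ext_seq (delta p) j'.
  rewrite /ext_seq /delta; case: (j' - lo) => m; last by rewrite mulr0 addr0.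
  by case: eqP => [->|_]; rewrite ?mulr1 ?mulr0 ?add0r ?addr0.
rewrite big_split /= -!mulr_suml -/A !ext_seq0 !mulr0 add0r tA sA (extE s) (extE t).
rewrite -/s' -/t'; ring.
Qed.

End Transport.

(** Rows 1 and 2 determine the weights: row 2 is [6 * s] shifted by one degree, and row 1 is
    [3 * s + t]. Then [alpha >= 0] gives [t >= 0], the later rows follow from the doubling
    relations, and [gamma >= 0] is three times the supply condition. *)
Lemma facet_degree v : facet_cone v -> degree_cone v.
Proof.
move=> [vV v0 valpha vgamma vrel]; have [N NE] := V_bound vV.
(* Low enough that the demand at index 0, which has no supply before it, vanishes. *)
pose lo := - N%:Z - 2.
pose a (m : nat) := v 0%N (lo + m%:Z).
pose s (m : nat) := v 2%N (lo + m%:Z + 1) / 6.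
pose t (m : nat) := v 1%N (lo + m%:Z) - 3 * s m.
have low i j : (i <= 2)%N -> j - lo <= 1 -> v i j = 0.
  by move=> i2 jlo; apply: NE => //; move: jlo; rewrite /lo; lia.
(* From this index on, the degree [lo + m] exceeds [N]. *)
have high (m : nat) : (N.*2 + 3 <= m)%N -> [/\ a m = 0, t m = 0 & s m = 0].
  move=> Nm; have s0 : s m = 0 by rewrite /s NE ?mul0r // /lo; lia.
  by rewrite /t s0 /a !NE ?mulr0 ?subrr // /lo; lia.
have Posz_ext f j (g : int -> rat) : (forall m : nat, f m = g (lo + m%:Z)) ->
    (j < lo -> g j = 0) -> ext_seq lo f j = g j.
  move=> fg g0; rewrite /ext_seq; case E : (j - lo) => [m|m].
    by rewrite fg; congr g; lia.
  by rewrite g0 //; lia.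
have ts0 : t 0%N + s 0%N = 0.
  by rewrite /t /s !low ?mul0r ?mulr0 ?subrr ?addr0 //; lia.
suff mixD : degree_cone (mix_table lo a t s).
  apply: cone_span_eq mixD.
  have sE j : ext_seq lo s j = v 2%N (j + 1) / 6.
    apply: (Posz_ext s j (fun j => v 2%N (j + 1) / 6)) => // jlo.
    by rewrite low ?mul0r //; lia.
  have row12 j : v 2%N j = 3 * 2 ^+ 1 * ext_seq lo s (j - 1%:Z).
    by rewrite sE subrK; field.
  move=> [|[|i]] j /=.
  - by rewrite (Posz_ext _ _ (v 0%N)) // => jlo; rewrite low //; lia.
  - rewrite (Posz_ext t j (fun j => v 1%N j - 3 * (v 2%N (j + 1) / 6))) //.
      by rewrite subr0 sE expr0; ring.
    by move=> jlo; rewrite !low ?mul0r ?mulr0 ?subrr //; lia.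
  rewrite mul0r addr0; elim: i j => [|i IHi] j; first by rewrite row12.
  have := vrel i.+2 (j - 1) isT; rewrite /epsilon subrK => <-.
  rewrite -IHi exprS; have -> : j - 1 - i.+1%:Z = j - i.+2%:Z by lia.
  ring.
apply: (@degree_cone_mix lo (N.*2 + 3) (N.*2 + 3) 0).
- by move=> m; apply: v0.
- move=> m; rewrite /t /s; have := valpha (lo + m%:Z); rewrite /alpha /epsilon; lra.
- by move=> m; rewrite /s mulr_ge0 // ; apply: v0.
- by move=> m /high[].
- by move=> m; rewrite ltn0 add0n /= => /high[].
- case=> [|l].
    by rewrite big_ord0 big_ord1 ts0.
  have := vgamma (lo + l%:Z); rewrite gammaE => [g0|]; last exact: gamma_term_low.
  rewrite [X in X <= _]big_ord_recl /= ts0 add0r.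
  rewrite -subr_ge0 -sumrB -(pmulr_rge0 _ (_ : 0 < 3)) // mulr_sumr.
  apply: le_trans g0 _; rewrite le_eqVlt; apply/orP; left; apply/eqP.
  apply: eq_bigr => m _; rewrite /gamma_term /a /t /s /bump /= add1n.
  have -> : lo + m.+1%:Z = lo + m%:Z + 1 by lia.
  have -> : lo + m%:Z + 1 + 1 = lo + m%:Z + 2 by lia.
  by field.
Qed.

(** * The cokernel of a homogeneous matrix as a graded module *)

Section Cokernel.
Variables (k : fieldType) (m n : nat) (D : 'M[B k]_(m, n)).

Definition row_image : {pred 'rV[B k]_n} :=
  fun w => `[< exists w', w = w' *m D >].

Lemma row_imageP w : reflect (exists w', w = w' *m D) (w \in row_image).
Proof. exact: asboolP. Qed.

Lemma row_image_zmod_closed : zmod_closed row_image.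
Proof.
split; first by apply/row_imageP; exists 0; rewrite mul0mx.
move=> u v /row_imageP[u' ->] /row_imageP[v' ->]; apply/row_imageP.
by exists (u' - v'); rewrite mulmxBl.
Qed.

HB.instance Definition _ :=
  GRing.isZmodClosed.Build 'rV[B k]_n row_image row_image_zmod_closed.

Definition coker : Type := Quotient.quot row_image.
HB.instance Definition _ := GRing.Zmodule.on coker.

Definition coker_proj (w : 'rV[B k]_n) : coker := \pi_(Quotient.quot row_image) w.

Lemma coker_proj_is_zmod_morphism : zmod_morphism coker_proj.
Proof. by move=> u v; rewrite /coker_proj !piE. Qed.

HB.instance Definition _ :=
  GRing.isZmodMorphism.Build 'rV[B k]_n coker coker_proj coker_proj_is_zmod_morphism.

Definition coker_repr (u : coker) : 'rV[B k]_n := repr (u : Quotient.quot row_image).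

Lemma coker_reprK : cancel coker_repr coker_proj.
Proof. by move=> u; rewrite /coker_proj /coker_repr reprK. Qed.

Lemma coker_proj_eq u v :
  coker_proj u = coker_proj v <-> exists w, u - v = w *m D.
Proof.
split=> [/eqP|/row_imageP]; last by rewrite Quotient.idealrBE => /eqP.
by rewrite -Quotient.idealrBE => /row_imageP.
Qed.

Lemma coker_proj_eq0 u : coker_proj u = 0 <-> exists w, u = w *m D.
Proof. by rewrite -(raddf0 coker_proj) coker_proj_eq subr0. Qed.

Definition coker_scale (b : B k) (u : coker) : coker := coker_proj (b *: coker_repr u).

Lemma coker_scaleE b w : coker_scale b (coker_proj w) = coker_proj (b *: w).
Proof.
apply/coker_proj_eq.
have /coker_proj_eq[w' E] := coker_reprK (coker_proj w).
by exists (b *: w'); rewrite -scalerBr E -scalemxAl.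
Qed.

Lemma coker_scaleA a b u : coker_scale a (coker_scale b u) = coker_scale (a * b) u.
Proof. by rewrite -[u]coker_reprK !coker_scaleE scalerA. Qed.

Lemma coker_scale1 : left_id 1 coker_scale.
Proof. by move=> u; rewrite -[u]coker_reprK coker_scaleE scale1r. Qed.

Lemma coker_scaleDr : right_distributive coker_scale +%R.
Proof.
move=> b u v; rewrite -[u]coker_reprK -[v]coker_reprK -raddfD !coker_scaleE.
by rewrite scalerDr raddfD.
Qed.

Lemma coker_scaleDl u : {morph coker_scale^~ u : a b / a + b}.
Proof.
by move=> a b; rewrite -[u]coker_reprK !coker_scaleE scalerDl raddfD.
Qed.

HB.instance Definition _ := GRing.Zmodule_isLmodule.Build (B k) coker
  coker_scaleA coker_scale1 coker_scaleDr coker_scaleDl.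

Lemma coker_projZ b w : coker_proj (b *: w) = b *: coker_proj w.
Proof. by rewrite -coker_scaleE. Qed.

Lemma coker_proj_row w :
  coker_proj w = \sum_a w 0 a *: coker_proj (delta_mx 0 a).
Proof.
rewrite {1}[w]row_sum_delta raddf_sum; apply: eq_bigr => a _.
exact: coker_projZ.
Qed.

Variables (d : 'I_m -> int) (e : 'I_n -> int).
Hypothesis D_homog : forall a b, Bhomog (d a - e b) (D a b).

Definition coker_piece (j : int) : set coker :=
  [set u | exists2 w, homog_row e j w & u = coker_proj w].

Lemma coker_piece0 j : coker_piece j 0.
Proof.
exists 0; last by rewrite raddf0.
by move=> a; rewrite mxE; apply: Bhomog0.
Qed.

Lemma coker_pieceB j u v :
  coker_piece j u -> coker_piece j v -> coker_piece j (u - v).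
Proof.
move=> [w hw ->] [w' hw' ->]; exists (w - w'); last by rewrite raddfB.
by move=> a; rewrite !mxE; apply: BhomogB.
Qed.

Lemma coker_pieceZ i j b u :
  Bhomog i b -> coker_piece j u -> coker_piece (i + j) (b *: u).
Proof.
move=> hb [w hw ->]; exists (b *: w); last by rewrite coker_projZ.
by move=> a; rewrite mxE -addrA; apply: BhomogM.
Qed.

Lemma Bcomp_sum_shift (b : B k) : exists N, forall c L, (c + N <= L)%N ->
  b = \sum_(i < L) Bcomp (i%:Z - c%:Z) b.
Proof.
have [N NE] := Bcomp_sum b; exists N; elim=> [|c IHc] L cNL.
  by rewrite {1}(NE L) //; apply: eq_bigr => i _; rewrite subr0.
case: L cNL => // L cNL; rewrite big_ord_recl sub0r add0r {1}(IHc L) //.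
by apply: eq_bigr => i _; congr (Bcomp _ b); rewrite lift0; lia.
Qed.

Lemma coker_decomp u : exists (s : seq int) (f : int -> coker),
  (forall j, coker_piece j (f j)) /\ u = \sum_(j <- s) f j.
Proof.
pose w := coker_repr u.
have /choice[N NE] a := Bcomp_sum_shift (w 0 a).
(* Total degrees start at [- K], so that every shift [c a = K + e a] is a natural number and one
   range of degrees serves all coordinates. *)
pose K := (\sum_a `|e a|)%N; pose c a := `|(K%:Z + e a)%R|%N.
have cE a : (c a)%:Z = K%:Z + e a by rewrite /c /K (bigD1 a) //=; lia.
pose L := (\sum_a (c a + N a))%N.
exists [seq (i%:Z - K%:Z)%R | i <- iota 0 L], (fun j => coker_proj (row_comp e j w)).
split=> [j|]; first by exists (row_comp e j w) => //; apply: row_comp_homog.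
rewrite -[LHS]coker_reprK -/w -raddf_sum; congr coker_proj.
apply/rowP => a; rewrite summxE {1}(NE a (c a) L); last first.
  by rewrite /L (bigD1 a) //= leq_addr.
have -> : iota 0 L = index_iota 0 L by rewrite /index_iota subn0.
rewrite big_map big_mkord; apply: eq_bigr => i _.
by rewrite mxE cE; congr (Bcomp _ _); lia.
Qed.

(** Homogeneous lifts of the summands add up to some [w' *m D]; taking components of degree [j]
    exhibits the lift of [f j] as an image. *)
Lemma coker_direct (s : seq int) (f : int -> coker) : uniq s ->
  (forall j, coker_piece j (f j)) -> \sum_(j <- s) f j = 0 ->
  forall j, j \in s -> f j = 0.
Proof.
move=> us fP f0 j js.
have /choice[w wP] i : exists w, homog_row e i w /\ f i = coker_proj w.
  by have [w] := fP i; exists w.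
have /coker_proj_eq0[w' wE] : coker_proj (\sum_(i <- s) w i) = 0.
  by rewrite raddf_sum -[RHS]f0; apply: eq_bigr => i _; case: (wP i).
case: (wP j) => hw ->; apply/coker_proj_eq0; exists (row_comp d j w').
rewrite -(row_comp_mul D_homog) -wE raddf_sum (bigD1_seq j) //=.
rewrite (row_comp_id _ hw) eqxx big1 ?addr0 // => i ij.
by case: (wP i) => hi _; rewrite (row_comp_id _ hi) eq_sym (negPf ij).
Qed.

Definition graded_coker : graded_module k :=
  @GradedModule k coker coker_piece coker_piece0 coker_pieceB coker_pieceZ
    coker_decomp coker_direct.

End Cokernel.

(** * Betti tables of resolutions with one strictly increasing degree per position *)

Section PureComplex.
Variables (k : fieldType) (r : nat -> nat) (delta : nat -> int).
Variable D : forall i, 'M[B k]_(r i.+1, r i).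
Hypothesis D_homog : forall i a b, Bhomog (delta i.+1 - delta i) (D i a b).
Hypothesis D_exact : forall i (w : 'rV[B k]_(r i.+1)),
  w *m D i = 0 <-> exists w', w = w' *m D i.+1.
Hypothesis delta_lt : forall i, delta i < delta i.+1.

Let M := graded_coker (fun a b => D_homog a b : Bhomog (delta 1 - delta 0) (D 0 a b)).

Definition pure_resolution : free_resolution M.
Proof.
refine (@FreeResolution k M r (fun i _ => delta i) D
  (fun a => coker_proj (D 0) (delta_mx 0 a)) D_homog _ _ _ D_exact).
- move=> a; exists (delta_mx 0 a) => // b; rewrite subrr mxE.
  case: (_ && _); last exact: Bhomog0.
  by exists 1; rewrite ?rmorph1 ?dhomog1.
- move=> u; exists (coker_repr u).
  by rewrite -(coker_proj_row (D 0)) coker_reprK.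
- by move=> w; rewrite -(coker_proj_row (D 0)); apply: coker_proj_eq0.
Defined.

(** All entries of the differentials have positive degree, so they vanish after tensoring with the
    field and the ranks can be read off. *)
Lemma pure_dim_Tor i j :
  dim_Tor pure_resolution i j = if j == delta i then r i else 0%N.
Proof.
have T0 i' : tens_diff pure_resolution i' = 0.
  apply/matrixP => a b; rewrite !mxE (Baug_homog 0 (D_homog a b)).
  by rewrite subr_eq0 gt_eqF.
rewrite /dim_Tor T0 mulmx0.
have degZ : (tens_deg pure_resolution i j <= tens_cycles pure_resolution i)%MS.
  case: i => [|i]; first exact: submx1.
  by apply/sub_kermxP; rewrite T0 mulmx0.
have := rank_quotient (sub0mx (r i.+1)
  (tens_cycles pure_resolution i :&: tens_deg pure_resolution i j)%MS).
rewrite mxrank0 add0n => ->; rewrite (capmx_idPr degZ) /tens_deg /= eq_sym.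
case: eqP => _.
  rewrite (_ : diag_mx _ = 1%:M) ?mxrank1 //.
  by apply/matrixP => a b; rewrite !mxE.
rewrite (_ : diag_mx _ = 0) ?mxrank0 //.
by apply/matrixP => a b; rewrite !mxE mul0rn.
Qed.

Lemma pure_betti :
  betti_cone k (fun i j => if j == delta i then (r i)%:R else 0).
Proof.
apply: cone_span_id; exists M; split.
  exists (r 0), (fun a => coker_proj (D 0) (delta_mx 0 a)) => u.
  exists (coker_repr u 0).
  by rewrite -(coker_proj_row (D 0)) coker_reprK.
exists pure_resolution => i j; rewrite pure_dim_Tor.
by case: eqP.
Qed.

End PureComplex.

(** * Explicit resolutions realising the pure tables *)

Section PureTables.
Variables (k : fieldType) (d0 d1 : int).
Hypothesis lt_d : d0 < d1.

Let deg (i : nat) : int := if i is i'.+1 then d1 + i'%:Z else d0.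

Let deg_lt i : deg i < deg i.+1.
Proof. by case: i => [|i] /=; lia. Qed.

Let n : nat := `|d1 - d0|.-1.

Let degE i : deg i.+1 - deg i = (if i is 0 then n else 0%N).+1%:Z.
Proof. by case: i => [|i] /=; rewrite /n; lia. Qed.

Lemma BvarX_homog v m : Bhomog (Posz m) (@Bvar k v ^+ m).
Proof.
elim: m => [|m IHm]; first by exists 1; rewrite ?rmorph1 ?dhomog1.
by rewrite exprS -[Posz m.+1]/(1 + Posz m); apply: BhomogM => //; apply: Bvar_homog.
Qed.

(** Powers of the variable cancel on its own axis, where the ring is a domain; on the other axes the
    variable is zero. *)
Lemma BvarX_ann v m (b : B k) : b * Bvar v ^+ m = 0 -> b * Bvar v = 0.
Proof.
move=> /(congr1 (axis v)); rewrite rmorphM rmorphXn rmorph0 /= axisX eqxx => /eqP.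
rewrite mulf_eq0 expf_eq0 polyX_eq0 andbF orbF => /eqP bv0.
apply: axis_ext => u; rewrite rmorphM rmorph0 /= axisX.
by case: eqP => [<-|_]; rewrite ?bv0 ?mul0r ?mulr0.
Qed.

Lemma betti_free : betti_cone k (fun i j =>
  if j == deg i then (if i is 0 then 1 else 0)%N%:R else 0).
Proof.
apply: (@pure_betti k (fun i => if i is 0 then 1 else 0)%N deg (fun i => 0)) => //.
- by move=> i a b; rewrite mxE; apply: Bhomog0.
- by move=> i w; split=> _; [exists 0; apply/rowP => -[] | rewrite mulmx0].
Qed.

(** The element [f] restricts to a nonzero power of the variable on each axis, hence is a
    nonzerodivisor. *)
Lemma betti_fin : betti_cone k (fun i j =>
  if j == deg i then (if (i <= 1)%N then 1 else 0)%N%:R else 0).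
Proof.
pose f : B k := \sum_v Bvar v ^+ n.+1.
apply: (@pure_betti k (fun i => if (i <= 1)%N then 1 else 0)%N deg
  (fun i => const_mx (if i == 0%N then f else 0))) => //.
- move=> i a b; rewrite mxE degE; case: i a b => [|i] a b; last exact: Bhomog0.
  by apply: Bhomog_sum => v; apply: BvarX_homog.
- move=> i w; split=> [wf|[w' ->]]; last first.
    by rewrite (_ : const_mx _ = 0 :> 'M_(_, (if (i.+1 <= 1)%N then 1 else 0))) ?mulmx0 ?mul0mx.
  exists 0; rewrite mul0mx; case: i w wf => [|i] w wf; apply/rowP => -[] //= a lt_a.
  have {}wf : w 0 (Ordinal lt_a) * f = 0.
    have /rowP/(_ 0) := wf; rewrite !mxE big_ord1 mxE => <-.
    by congr (w _ _ * f); apply/val_inj; case: a lt_a.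
  rewrite [RHS]mxE; apply: axis_ext => v; move: wf => /(congr1 (axis v)).
  rewrite rmorphM !rmorph0 /= rmorph_sum (bigD1 v) //= big1 => [|u uv].
    rewrite addr0 rmorphXn /= axisX eqxx => /eqP.
    by rewrite mulf_eq0 expf_eq0 polyX_eq0 andbF orbF => /eqP.
  by rewrite rmorphXn /= axisX (negPf uv) expr0n.
Qed.

(* The generators of the i.+1-st free module are the nodes of depth i of a
   forest of three binary trees; the node a of depth i carries a variable,
   different from those of its parent a./2 and of its sibling. *)
Fixpoint node_var (i a : nat) : 'I_3 :=
  if i is i'.+1 then node_var i' a./2 + (if odd a then 2 else 1) else inord a.

Let rank (i : nat) : nat := if i is i'.+1 then (3 * 2 ^ i')%N else 1%N.

Let par (i a b : nat) : bool := if i is 0 then true else a./2 == b.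

(** Each node maps to its variable times its parent. The three roots map to the single generator in
    position 0 by powers with exponent [d1 - d0]; all later maps are linear. *)
Let D (i : nat) : 'M[B k]_(rank i.+1, rank i) := \matrix_(a, b)
  if par i a b then Bvar (node_var i a) ^+ (if i is 0 then n else 0).+1 else 0.

Let lt_rank i (a : nat) : (a < rank i.+2)%N = (a./2 < rank i.+1)%N.
Proof. by rewrite /= expnS; lia. Qed.

Let node_par i (a : 'I_(rank i.+1)) : exists b : 'I_(rank i), par i a b.
Proof.
case: i a => [|i] a; first by exists 0.
have lt_a : (a./2 < rank i.+1)%N by rewrite -lt_rank.
by exists (Ordinal lt_a); rewrite /par /=.
Qed.

Let node_sibling i (a a' : 'I_(rank i.+1)) b : par i a b -> par i a' b ->
  node_var i a = node_var i a' -> a = a'.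
Proof.
case: i a a' => [|i] a a' /=.
  by move=> _ _ /(congr1 val) /=; rewrite !inordK // => /val_inj.
move=> /eqP <- /eqP aa' /eqP; rewrite aa' (inj_eq (addrI _)) => odda.
apply/val_inj; rewrite /= -[LHS]odd_double_half -[RHS]odd_double_half aa'.
by congr (_ + _)%N; move: odda; case: (odd a); case: (odd a').
Qed.

Let node_child i a : node_var i.+1 a != node_var i a./2.
Proof. by rewrite /= -subr_eq0 addrC addKr; case: odd. Qed.

(** Siblings carry distinct variables, whose products vanish, so multiplying a column by the
    variable of one node isolates the entry of that node. *)
Let D_ker i (w : 'rV[B k]_(rank i.+1)) :
  w *m D i = 0 <-> forall a, w 0 a * Bvar (node_var i a) = 0.
Proof.
split=> [wD a | w0].
  have [b ab] := node_par a.
  have /rowP/(_ b) := wD; rewrite !mxE => /(congr1 ( *%R^~ (Bvar (node_var i a)))).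
  rewrite mul0r mulr_suml (bigD1 a) //= big1 => [|a' a'a].
    by rewrite addr0 mxE ab -mulrA -exprSr => /BvarX_ann.
  rewrite mxE; case: ifP => [a'b|_]; last by rewrite mulr0 mul0r.
  have vv : node_var i a' != node_var i a.
    by apply: contraNneq a'a => /(node_sibling a'b ab)->.
  by rewrite -mulrA exprSr -mulrA BvarM ?mulr0.
apply/rowP => b; rewrite !mxE big1 // => a _; rewrite mxE.
case: ifP => _; last by rewrite mulr0.
by rewrite exprS mulrA w0 mul0r.
Qed.

Let sum_not v (f : 'I_3 -> B k) : \sum_(u | u != v) f u = f (v + 1) + f (v + 2).
Proof.
rewrite (bigD1 (v + 1)) /=; last by rewrite -subr_eq0 addrC addKr.
rewrite (bigD1 (v + 2)) /=; last by rewrite -subr_eq0 addrC addKr (inj_eq (addrI v)).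
rewrite big1 ?addr0 // => u /andP[/andP[]].
rewrite -[u](subrK v) -[X in _ != X]add0r ![_ + v]addrC !(inj_eq (addrI v)).
by case: (u - v) => [[|[|[|//]]]].
Qed.

(** By [D_ker] each entry is annihilated by the variable of its node. The annihilator is generated
    by the two other variables, which are those of the two children [a.*2] and [a.*2.+1]. *)
Let D_exact i (w : 'rV[B k]_(rank i.+1)) :
  w *m D i = 0 <-> exists w', w = w' *m D i.+1.
Proof.
rewrite D_ker; split=> [w0|[w' ->] a]; last first.
  rewrite mxE mulr_suml big1 // => c _; rewrite mxE.
  case: ifP => [/eqP ca|_]; last by rewrite mulr0 mul0r.
  by rewrite -mulrA expr1 BvarM ?mulr0 // -ca node_child.
have /choice[q qE] a := Bvar_ann (w0 a).
have lt_half (c : 'I_(rank i.+2)) : (c./2 < rank i.+1)%N.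
  by rewrite -lt_rank.
exists (\row_c q (Ordinal (lt_half c)) (node_var i.+1 c)).
apply/rowP => a; rewrite qE mxE sum_not.
have lt0 : (a.*2 < rank i.+2)%N by rewrite lt_rank doubleK.
have lt1 : (a.*2.+1 < rank i.+2)%N by rewrite lt_rank /= uphalf_double.
rewrite (bigD1 (Ordinal lt0)) //= (bigD1 (Ordinal lt1)) /=; last first.
  by rewrite -val_eqE /=; lia.
rewrite [X in _ = _ + (_ + X)]big1 ?addr0 => [|c /andP[c0 c1]].
  have half0 : Ordinal (lt_half (Ordinal lt0)) = a.
    by apply/val_inj; rewrite /= doubleK.
  have half1 : Ordinal (lt_half (Ordinal lt1)) = a.
    by apply/val_inj; rewrite /= uphalf_double.
  by rewrite !mxE half0 half1 /= uphalf_double doubleK odd_double /= eqxx !expr1.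
rewrite [D _ _ _]mxE ifN ?mulr0 //=; move: c0 c1; rewrite -!val_eqE /=; lia.
Qed.

Lemma betti_inf : betti_cone k (fun i j =>
  if j == deg i then (if i is i'.+1 then 3 * 2 ^ i' else 1)%N%:R else 0).
Proof.
apply: (@pure_betti k rank deg D) => // i a b; rewrite mxE degE.
by case: ifP => _; [apply: BvarX_homog | apply: Bhomog0].
Qed.

End PureTables.

Lemma pure_table_betti (k : fieldType) d : betti_cone k (pure_table d).
Proof.
case: d => [d0|d0 d1 lt_d|d0 d1 lt_d].
(* The second degree is a placeholder: the free modules after position 0 have rank 0. *)
- have lt_d : d0 < d0 + 1 by lia.
  apply: cone_span_eq (betti_free k lt_d) => -[|i] j; rewrite pure_tableE /= ?if_same //.
  by case: eqP; rewrite ?mulr1.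
- apply: cone_span_eq (betti_fin k lt_d) => -[|[|i]] j; rewrite pure_tableE /= ?if_same //.
    by case: eqP; rewrite ?mulr1.
  by rewrite addr0; case: eqP; rewrite ?mulr1.
- apply: cone_span_eq (betti_inf k lt_d) => -[|i] j; rewrite pure_tableE /=.
    by case: eqP; rewrite ?mulr1.
  by rewrite natrM natrX; case: eqP; rewrite ?mul1r ?mul0r.
Qed.

Theorem theorem3p1 (k : fieldType) :
  betti_cone k = degree_cone /\ degree_cone = facet_cone.
Proof.
have BF : betti_cone k `<=` facet_cone.
  move=> v [n [c [t [c0 tB vE]]]]; apply: facet_cone_span; exists n, c, t.
  by split=> // l; have [M [_ /betti_facet]] := tB l.
have FD : facet_cone `<=` degree_cone by apply: facet_degree.
have DB : degree_cone `<=` betti_cone k.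
  by apply: cone_span_sub => _ [d _ <-]; apply: pure_table_betti.
split; apply/seteqP; split=> v.
- by move/BF/FD.
- exact: DB.
- by move/DB/BF.
- exact: FD.
Qed.
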